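(* Let $\phi$ be a Drinfeld $A$-module over a field $L$ with characteristic $\mathfrak p=\ker\iota$, and let $\mathfrak q$ be a nonzero prime of $A$ with $\mathfrak q\neq\mathfrak p$. There is a Galois-equivariant continuous perfect pairing of $A_{\mathfrak q}$-modules $$[\;,\;]_{\mathfrak q}:T_{\mathfrak q}(\phi)\times T_{\mathfrak q}(\phi^\ast)\to\operatorname{Hom}_{\mathbb F_q}(K_{\mathfrak q}/A_{\mathfrak q},\mathbb F_q),$$ and $\operatorname{Hom}_{\mathbb F_q}(K_{\mathfrak q}/A_{\mathfrak q},\mathbb F_q)$ is (non-canonically) isomorphic to $A_{\mathfrak q}$ as an $A_{\mathfrak q}$-module.
   Context: Let $q$ be a power of a prime $p$, $X$ a nonsingular projective curve over $\mathbb F_q$, $\infty$ a closed point, $A$ the ring of regular functions on $X\setminus\{\infty\}$, $K$ its fraction field, and $A_{\mathfrak q},K_{\mathfrak q}$ the completions at $\mathfrak q$. Let $L$ be a field with an $\mathbb F_q$-algebra homomorphism $\iota:A\to L$; a Drinfeld $A$-module over $L$ is a ring homomorphism $\phi:A\to L\{\tau\}$, $a\mapsto\phi_a=\sum c_i\tau^i$ (acting on $\overline L$ by $z\mapsto\sum c_iz^{q^i}$, multiplication = composition) with $\tau^0$-coefficient $\iota(a)$ and image not in $L$. The adjoint of $\sum c_n\tau^n$ is $\sum c_n^{1/q^n}\tau^{-n}$, acting on $\overline L$ via $z\mapsto\sum c_n^{1/q^n}z^{1/q^n}$. Let $\phi(\overline L)$ (resp. $\phi^\ast(\overline L)$) be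 $\overline L$ with $A$ acting by $c\cdot z=\phi_c(z)$ (resp. $\phi_c^\ast(z)$). The Tate modules are $T_{\mathfrak q}(\phi)=\operatorname{Hom}_A(K_{\mathfrak q}/A_{\mathfrak q},\phi(\overline L))$ and $T_{\mathfrak q}(\phi^\ast)=\operatorname{Hom}_A(K_{\mathfrak q}/A_{\mathfrak q},\phi^\ast(\overline L))$, $A_{\mathfrak q}$-modules with their natural profinite topologies, on which automorphisms of $\overline L$ over $L$ act. $\operatorname{Hom}_{\mathbb F_q}(K_{\mathfrak q}/A_{\mathfrak q},\mathbb F_q)$ is an $A_{\mathfrak q}$-module via $(c\cdot\chi)(x)=\chi(cx)$, with trivial Galois action. Perfect means both induced maps into $\operatorname{Hom}_{A_{\mathfrak q}}(\,\cdot\,,\operatorname{Hom}_{\mathbb F_q}(K_{\mathfrak q}/A_{\mathfrak q},\mathbb F_q))$ are isomorphisms. *)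

(* Defs.v *)
From HB Require Import structures.
From mathcomp Require Import all_boot all_order all_algebra all_field.
From mathcomp Require Import all_classical topology.

Set Implicit Arguments.
Unset Strict Implicit.
Unset Printing Implicit Defensive.

Import GRing.Theory.
Local Open Scope ring_scope.

Section Frobenius.
Variables (Fq : finFieldType) (L : fieldType) (k : {rmorphism Fq -> L}).

Lemma pnat_card n : [pchar L].-nat (#|Fq| ^ n)%N.
Proof.
have [p p_pr cFp] := finPcharP Fq.
have cLp : p \in [pchar L] by apply: (rmorph_pchar k).
rewrite pnatX; apply/orP; left.
rewrite (eq_pnat _ (pcharf_eq cLp)).
have := card_pprimeChar cFp; rewrite /= => ->.
by rewrite pnatX pnat_id.
Qed.

Lemma frobD n (x y : L) :
  (x + y) ^+ (#|Fq| ^ n) = x ^+ (#|Fq| ^ n) + y ^+ (#|Fq| ^ n).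
Proof. exact: exprDn_pchar (pnat_card n). Qed.

Lemma frob0 n : 0 ^+ (#|Fq| ^ n) = 0 :> L.
Proof. by rewrite expr0n expn_eq0; case: #|Fq| (fintype0 (0 : Fq)) => [[]|]. Qed.

Lemma frob_inj n : injective (fun x : L => x ^+ (#|Fq| ^ n)).
Proof.
move=> x y xy; apply/eqP; rewrite -subr_eq0; apply/eqP.
have: (x - y) ^+ (#|Fq| ^ n) = 0.
  by apply: (addIr (y ^+ (#|Fq| ^ n))); rewrite -frobD subrK add0r.
by move/eqP; rewrite expf_eq0 => /andP[_ /eqP].
Qed.

End Frobenius.

Section SumCoef.
Variables (R : nzRingType) (V : zmodType) (F : nat -> R -> V).
Hypothesis FD : forall i x y, F i (x + y) = F i x + F i y.

Definition sum_coef (f : {poly R}) := \sum_(i < size f) F i f`_i.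

Let F0 i : F i 0 = 0.
Proof. by apply: (addIr (F i 0)); rewrite -FD !add0r. Qed.

Lemma sum_coef_wide N (f : {poly R}) :
  (size f <= N)%N -> sum_coef f = \sum_(i < N) F i f`_i.
Proof.
move=> leN; rewrite /sum_coef (big_ord_widen _ (fun i => F i f`_i) leN) big_mkcond.
by apply: eq_bigr => i _; case: ltnP => // ?; rewrite nth_default.
Qed.

Lemma sum_coefD f g : sum_coef (f + g) = sum_coef f + sum_coef g.
Proof.
pose N := maxn (size (f + g)) (maxn (size f) (size g)).
rewrite !(@sum_coef_wide N) ?leq_max ?leqnn ?orbT //.
by rewrite -big_split; apply: eq_bigr => i _; rewrite coefD FD.
Qed.

Lemma sum_coef0 : sum_coef 0 = 0.
Proof. by rewrite /sum_coef size_poly0 big_ord0. Qed.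

Lemma sum_coefZX a n : sum_coef (a *: 'X^n) = F n a.
Proof.
rewrite (@sum_coef_wide n.+1); last first.
  by apply: leq_trans (size_scale_leq _ _) _; rewrite size_polyXn.
rewrite big_ord_recr /= big1 ?add0r => [|i _].
  by rewrite coefZ coefXn eqxx mulr1.
by rewrite coefZ coefXn ltn_eqF ?mulr0 //= F0.
Qed.

End SumCoef.

Lemma poly_add_ind (R : nzRingType) (P : {poly R} -> Prop) :
  P 0 -> (forall f g, P f -> P g -> P (f + g)) ->
  (forall a n, P (a *: 'X^n)) -> forall f, P f.
Proof.
move=> P0 PD PX f; rewrite -[f]coefK poly_def.
by apply: (big_ind P) => // i _; apply: PX.
Qed.

(* [twisted k] is L{tau}: the coefficient of tau^i of f is f`_i, and the       *)
(* product is determined by (a tau^i) (b tau^j) = a b^(q^i) tau^(i+j) with     *)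
(* q = #|Fq|. The argument k makes L an Fq-algebra.                            *)
Definition twisted (Fq : finFieldType) (L : fieldType)
  (k : {rmorphism Fq -> L}) : Type := {poly L}.

Section Twisted.
Variables (Fq : finFieldType) (L : fieldType) (k : {rmorphism Fq -> L}).
Local Notation q := #|Fq|.

HB.instance Definition _ := GRing.Zmodule.copy (twisted k) {poly L}.

Definition twisted_mul (f g : {poly L}) : {poly L} :=
  \sum_(i < size f) \sum_(j < size g) (f`_i * g`_j ^+ (q ^ i)) *: 'X^(i + j).

Let rowF (g : {poly L}) i (a : L) : {poly L} :=
  \sum_(j < size g) (a * g`_j ^+ (q ^ i)) *: 'X^(i + j).
Let colF i a j (b : L) : {poly L} := (a * b ^+ (q ^ i)) *: 'X^(i + j).

Let rowFD g i a b : rowF g i (a + b) = rowF g i a + rowF g i b.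
Proof. by rewrite -big_split; apply: eq_bigr => j _; rewrite mulrDl scalerDl. Qed.
Let colFD i a j b c : colF i a j (b + c) = colF i a j b + colF i a j c.
Proof. by rewrite /colF (frobD k) mulrDr scalerDl. Qed.

Lemma twisted_mulDl : left_distributive twisted_mul +%R.
Proof. by move=> f g h; apply: (sum_coefD (rowFD h)). Qed.

Lemma twisted_mulDr : right_distributive twisted_mul +%R.
Proof.
move=> f g h; rewrite -big_split; apply: eq_bigr => i _.
exact: (sum_coefD (colFD i f`_i)).
Qed.

Lemma twisted_mul0l f : twisted_mul 0 f = 0.
Proof. by rewrite /twisted_mul size_poly0 big_ord0. Qed.

Lemma twisted_mul0r f : twisted_mul f 0 = 0.
Proof. by rewrite /twisted_mul big1 // => i _; rewrite size_poly0 big_ord0. Qed.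

Lemma twisted_mulX a b i j :
  twisted_mul (a *: 'X^i) (b *: 'X^j) = (a * b ^+ (q ^ i)) *: 'X^(i + j).
Proof.
by rewrite [LHS](sum_coefZX (rowFD _)) /rowF; exact: (sum_coefZX (colFD i a)).
Qed.

Lemma twisted_mulA : associative twisted_mul.
Proof.
move=> f g h; elim/poly_add_ind: f => [|f f' IH IH'|a i].
- by rewrite !twisted_mul0l.
- by rewrite !twisted_mulDl IH IH'.
elim/poly_add_ind: g => [|g g' IH IH'|b j].
- by rewrite twisted_mul0l twisted_mul0r twisted_mul0l.
- by rewrite twisted_mulDl !twisted_mulDr twisted_mulDl IH IH'.
elim/poly_add_ind: h => [|h h' IH IH'|c l].
- by rewrite !twisted_mul0r.
- by rewrite !twisted_mulDr IH IH'.
by rewrite !twisted_mulX addnA exprMn -exprM mulrA -expnD addnC.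
Qed.

Lemma twisted_mul1l : left_id 1 twisted_mul.
Proof.
have -> : 1 = 1 *: 'X^0 :> {poly L} by rewrite scale1r expr0.
elim/poly_add_ind => [|f f' IH IH'|a i]; first exact: twisted_mul0r.
  by rewrite twisted_mulDr IH IH'.
by rewrite twisted_mulX mul1r expn0 expr1.
Qed.

Lemma twisted_mul1r : right_id 1 twisted_mul.
Proof.
have -> : 1 = 1 *: 'X^0 :> {poly L} by rewrite scale1r expr0.
elim/poly_add_ind => [|f f' IH IH'|a i]; first exact: twisted_mul0l.
  by rewrite twisted_mulDl IH IH'.
by rewrite twisted_mulX expr1n mulr1 addn0.
Qed.

HB.instance Definition _ := GRing.Zmodule_isNzRing.Build (twisted k)
  twisted_mulA twisted_mul1l twisted_mul1r twisted_mulDl twisted_mulDr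
  (oner_neq0 {poly L}).

End Twisted.

Section Action.
Variables (Fq : finFieldType) (L : fieldType) (Lbar : closedFieldType).
Variables (k : {rmorphism Fq -> L}) (emb : {rmorphism L -> Lbar}).
Local Notation q := #|Fq|.

Definition twisted_act (f : twisted k) (z : Lbar) : Lbar :=
  \sum_(i < size (f : {poly L})) emb (f : {poly L})`_i * z ^+ (q ^ i).

(* Frobenius is bijective on Lbar, so this is the q^n-th root. *)
Definition qroot n (z : Lbar) : Lbar := xget 0 [set w | w ^+ (q ^ n) = z].

Definition adjoint_act (f : twisted k) (z : Lbar) : Lbar :=
  \sum_(i < size (f : {poly L})) qroot i (emb (f : {poly L})`_i) * qroot i z.

Let kbar : {rmorphism Fq -> Lbar} := emb \o k.

Lemma qrootK n z : qroot n z ^+ (q ^ n) = z.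
Proof.
have q_gt0 : (0 < q ^ n)%N.
  by rewrite expn_gt0; case: #|Fq| (fintype0 (0 : Fq)) => [[]|].
have [w Hw] := solve_monicpoly (fun i => if i == 0%N then z else 0) q_gt0.
suff E : exists w : Lbar, w ^+ (q ^ n) = z by exact: (xgetPex 0 E).
exists w; rewrite Hw; case: (q ^ n)%N q_gt0 => // m _.
by rewrite big_ord_recl /= expr0 mulr1 big1 ?addr0 // => i _; rewrite mul0r.
Qed.

Lemma qroot_eq n w z : w ^+ (q ^ n) = z -> qroot n z = w.
Proof. by move=> Hw; apply: (frob_inj kbar (n := n)); rewrite qrootK. Qed.

Lemma qrootD n x y : qroot n (x + y) = qroot n x + qroot n y.
Proof. by apply: qroot_eq; rewrite (frobD kbar) !qrootK. Qed.

Lemma qrootM n x y : qroot n (x * y) = qroot n x * qroot n y.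
Proof. by apply: qroot_eq; rewrite exprMn !qrootK. Qed.

Lemma qroot_qroot m n z : qroot m (qroot n z) = qroot (n + m) z.
Proof. by apply/esym/qroot_eq; rewrite expnD mulnC exprM !qrootK. Qed.

Lemma qrootX m n z : qroot (m + n) (z ^+ (q ^ m)) = qroot n z.
Proof. by apply: qroot_eq; rewrite expnD mulnC exprM qrootK. Qed.

Let actF z i a := emb a * z ^+ (q ^ i).
Let adjF z i a := qroot i (emb a) * qroot i z.
Let actFD z i a b : actF z i (a + b) = actF z i a + actF z i b.
Proof. by rewrite /actF rmorphD mulrDl. Qed.
Let adjFD z i a b : adjF z i (a + b) = adjF z i a + adjF z i b.
Proof. by rewrite /adjF rmorphD qrootD mulrDl. Qed.

Lemma twisted_actDl f g z : twisted_act (f + g) z = twisted_act f z + twisted_act g z.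
Proof. exact: (sum_coefD (actFD z)). Qed.

Lemma adjoint_actDl f g z : adjoint_act (f + g) z = adjoint_act f z + adjoint_act g z.
Proof. exact: (sum_coefD (adjFD z)). Qed.

Lemma twisted_actDr f x y : twisted_act f (x + y) = twisted_act f x + twisted_act f y.
Proof.
by rewrite -big_split; apply: eq_bigr => i _; rewrite (frobD kbar) mulrDr.
Qed.

Lemma adjoint_actDr f x y : adjoint_act f (x + y) = adjoint_act f x + adjoint_act f y.
Proof.
by rewrite -big_split; apply: eq_bigr => i _; rewrite qrootD mulrDr.
Qed.

Lemma twisted_act0 z : twisted_act 0 z = 0.
Proof. exact: (sum_coef0 (actF z)). Qed.

Lemma adjoint_act0 z : adjoint_act 0 z = 0.
Proof. exact: (sum_coef0 (adjF z)). Qed.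

Lemma twisted_act0r f : twisted_act f 0 = 0.
Proof. by apply: (addIr (twisted_act f 0)); rewrite -twisted_actDr !add0r. Qed.

Lemma adjoint_act0r f : adjoint_act f 0 = 0.
Proof. by apply: (addIr (adjoint_act f 0)); rewrite -adjoint_actDr !add0r. Qed.

Lemma twisted_actZX a n z : twisted_act (a *: 'X^n : {poly L}) z = emb a * z ^+ (q ^ n).
Proof. exact: (sum_coefZX (actFD z)). Qed.

Lemma adjoint_actZX a n z :
  adjoint_act (a *: 'X^n : {poly L}) z = qroot n (emb a) * qroot n z.
Proof. exact: (sum_coefZX (adjFD z)). Qed.

Lemma twisted_act1 z : twisted_act 1 z = z.
Proof.
have -> : (1 : twisted k) = (1 *: 'X^0 : {poly L}) by rewrite scale1r expr0.
by rewrite twisted_actZX rmorph1 mul1r expn0 expr1.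
Qed.

Lemma adjoint_act1 z : adjoint_act 1 z = z.
Proof.
have -> : (1 : twisted k) = (1 *: 'X^0 : {poly L}) by rewrite scale1r expr0.
have r0 x : qroot 0 x = x by apply: qroot_eq; rewrite expn0 expr1.
by rewrite adjoint_actZX !r0 rmorph1 mul1r.
Qed.

Lemma twisted_actM f g z : twisted_act (f * g) z = twisted_act f (twisted_act g z).
Proof.
elim/poly_add_ind: f => [|f f' IH IH'|a i].
- by rewrite [0 * _]mul0r !twisted_act0.
- by rewrite [(_ + _) * _]mulrDl !twisted_actDl IH IH'.
elim/poly_add_ind: g => [|g g' IH IH'|b j].
- by rewrite [_ * 0]mulr0 !twisted_act0 twisted_act0r.
- by rewrite [_ * (_ + _)]mulrDr !twisted_actDl twisted_actDr IH IH'.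
rewrite [_ * _](twisted_mulX k) !twisted_actZX rmorphM rmorphXn exprMn -mulrA.
by rewrite -exprM -expnD [(j + i)%N]addnC.
Qed.

Lemma adjoint_actM f g z : adjoint_act (f * g) z = adjoint_act g (adjoint_act f z).
Proof.
elim/poly_add_ind: f => [|f f' IH IH'|a i].
- by rewrite [0 * _]mul0r !adjoint_act0 adjoint_act0r.
- by rewrite [(_ + _) * _]mulrDl !adjoint_actDl adjoint_actDr IH IH'.
elim/poly_add_ind: g => [|g g' IH IH'|b j].
- by rewrite [_ * 0]mulr0 !adjoint_act0.
- by rewrite [_ * (_ + _)]mulrDr !adjoint_actDl IH IH'.
rewrite [_ * _](twisted_mulX k) !adjoint_actZX rmorphM rmorphXn !qrootM.
by rewrite !qroot_qroot qrootX mulrCA mulrA.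
Qed.

End Action.

(* L is an Fq-algebra through iota, so iota is an Fq-algebra homomorphism. *)
Record drinfeld_module (Fq : finFieldType) (A : comAlgType Fq) (L : fieldType)
    (iota : {rmorphism A -> L}) := DrinfeldModule {
  drinfeld_fun :> {rmorphism A -> twisted (iota \o GRing.in_alg A)};
  drinfeld_const : forall a, (drinfeld_fun a : {poly L})`_0 = iota a;
  drinfeld_nonconst : exists a, forall c, (drinfeld_fun a : {poly L}) <> c%:P
}.

Definition drinfeld_points (Fq : finFieldType) (A : comAlgType Fq)
  (L : fieldType) (Lbar : closedFieldType) (iota : {rmorphism A -> L})
  (phi : drinfeld_module iota) (emb : {rmorphism L -> Lbar}) : Type := Lbar.

Definition adjoint_points (Fq : finFieldType) (A : comAlgType Fq)
  (L : fieldType) (Lbar : closedFieldType) (iota : {rmorphism A -> L})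
  (phi : drinfeld_module iota) (emb : {rmorphism L -> Lbar}) : Type := Lbar.

Section Points.
Variables (Fq : finFieldType) (A : comAlgType Fq) (L : fieldType).
Variables (Lbar : closedFieldType) (iota : {rmorphism A -> L}).
Variables (phi : drinfeld_module iota) (emb : {rmorphism L -> Lbar}).

Local Notation drinfeld_points := (drinfeld_points phi emb).
Local Notation adjoint_points := (adjoint_points phi emb).

HB.instance Definition _ := GRing.Zmodule.copy drinfeld_points Lbar.
HB.instance Definition _ := GRing.Zmodule.copy adjoint_points Lbar.

Definition drinfeld_scale (a : A) (z : drinfeld_points) : drinfeld_points :=
  twisted_act emb (phi a) z.
Definition adjoint_scale (a : A) (z : adjoint_points) : adjoint_points :=
  adjoint_act emb (phi a) z.

Fact drinfeld_scaleA a b z :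
  drinfeld_scale a (drinfeld_scale b z) = drinfeld_scale (a * b) z.
Proof. by rewrite /drinfeld_scale rmorphM twisted_actM. Qed.
Fact drinfeld_scale1 : left_id 1 drinfeld_scale.
Proof. by move=> z; rewrite /drinfeld_scale rmorph1 twisted_act1. Qed.
Fact drinfeld_scaleDr : right_distributive drinfeld_scale +%R.
Proof. by move=> a y z; apply: twisted_actDr. Qed.
Fact drinfeld_scaleDl z : {morph drinfeld_scale^~ z : a b / a + b}.
Proof. by move=> a b; rewrite /drinfeld_scale rmorphD twisted_actDl. Qed.

HB.instance Definition _ := GRing.Zmodule_isLmodule.Build A drinfeld_points
  drinfeld_scaleA drinfeld_scale1 drinfeld_scaleDr drinfeld_scaleDl.

Fact adjoint_scaleA a b z :
  adjoint_scale a (adjoint_scale b z) = adjoint_scale (a * b) z.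
Proof. by rewrite /adjoint_scale mulrC rmorphM adjoint_actM. Qed.
Fact adjoint_scale1 : left_id 1 adjoint_scale.
Proof. by move=> z; rewrite /adjoint_scale rmorph1 adjoint_act1. Qed.
Fact adjoint_scaleDr : right_distributive adjoint_scale +%R.
Proof. by move=> a y z; apply: adjoint_actDr. Qed.
Fact adjoint_scaleDl z : {morph adjoint_scale^~ z : a b / a + b}.
Proof. by move=> a b; rewrite /adjoint_scale rmorphD adjoint_actDl. Qed.

HB.instance Definition _ := GRing.Zmodule_isLmodule.Build A adjoint_points
  adjoint_scaleA adjoint_scale1 adjoint_scaleDr adjoint_scaleDl.

End Points.

Record galois_aut (L : fieldType) (Lbar : closedFieldType)
    (emb : {rmorphism L -> Lbar}) := GaloisAut {
  galois_fun :> {rmorphism Lbar -> Lbar};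
  galois_bij : bijective galois_fun;
  galois_fix : forall x, galois_fun (emb x) = emb x
}.

Section GaloisPoints.
Variables (Fq : finFieldType) (A : comAlgType Fq) (L : fieldType).
Variables (Lbar : closedFieldType) (iota : {rmorphism A -> L}).
Variables (phi : drinfeld_module iota) (emb : {rmorphism L -> Lbar}).
Variable sigma : galois_aut emb.

Definition galois_drinfeld (z : drinfeld_points phi emb) :
  drinfeld_points phi emb := sigma z.
Definition galois_adjoint (z : adjoint_points phi emb) :
  adjoint_points phi emb := sigma z.

Fact galois_drinfeld_linear : linear galois_drinfeld.
Proof.
move=> a y z; rewrite /galois_drinfeld [LHS]rmorphD; congr (_ + _).
rewrite [LHS]rmorph_sum; apply: eq_bigr => i _.
by rewrite rmorphM rmorphXn galois_fix.
Qed.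

Fact galois_adjoint_linear : linear galois_adjoint.
Proof.
move=> a y z; rewrite /galois_adjoint [LHS]rmorphD; congr (_ + _).
have sr n x : sigma (qroot Fq n x) = qroot Fq n (sigma x).
  apply/esym/(qroot_eq (iota \o GRing.in_alg A) emb).
  by rewrite -rmorphXn qrootK.
rewrite [LHS]rmorph_sum; apply: eq_bigr => i _.
by rewrite rmorphM !sr galois_fix.
Qed.

HB.instance Definition _ := GRing.isLinear.Build A _ _ _ galois_drinfeld
  galois_drinfeld_linear.
HB.instance Definition _ := GRing.isLinear.Build A _ _ _ galois_adjoint
  galois_adjoint_linear.

End GaloisPoints.

(* [quot_hom r e M] is Hom_R(K/A, M) for ring maps r : R -> A and e : A -> K,  *)
(* an element being given by its composite with K -> K/A.                      *)
Record quot_hom (R A : comNzRingType) (K : fieldType) (r : {rmorphism R -> A})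
    (e : {rmorphism A -> K}) (M : lmodType R) := QuotHom {
  quot_hom_fun :> K -> M;
  quot_homD : forall x y, quot_hom_fun (x + y) = quot_hom_fun x + quot_hom_fun y;
  quot_hom_int : forall c, quot_hom_fun (e c) = 0;
  quot_homZ : forall a x, quot_hom_fun (e (r a) * x) = a *: quot_hom_fun x
}.

Section QuotHom.
Variables (R A : comNzRingType) (K : fieldType) (r : {rmorphism R -> A}).
Variables (e : {rmorphism A -> K}) (M : lmodType R).
Local Notation H := (quot_hom r e M).

Lemma quot_hom_ext (f g : H) : f =1 g -> f = g.
Proof.
case: f g => [f f1 f2 f3] [g g1 g2 g3] /= /funext fg.
by subst g; congr QuotHom; apply: Prop_irrelevance.
Qed.

HB.instance Definition _ := gen_eqMixin H.
HB.instance Definition _ := gen_choiceMixin H.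

Definition quot_hom_zero : H.
Proof.
by exists (fun=> 0) => *; rewrite ?addr0 ?scaler0.
Defined.

Definition quot_hom_opp (f : H) : H.
Proof.
exists (fun x => - f x) => *.
- by rewrite quot_homD opprD.
- by rewrite quot_hom_int oppr0.
- by rewrite quot_homZ scalerN.
Defined.

Definition quot_hom_add (f g : H) : H.
Proof.
exists (fun x => f x + g x) => *.
- by rewrite !quot_homD addrACA.
- by rewrite !quot_hom_int addr0.
- by rewrite !quot_homZ scalerDr.
Defined.

Definition quot_hom_scale (c : A) (f : H) : H.
Proof.
exists (fun x => f (e c * x)) => *.
- by rewrite mulrDr quot_homD.
- by rewrite -rmorphM quot_hom_int.
- by rewrite mulrCA quot_homZ.
Defined.

Fact quot_hom_addA : associative quot_hom_add.
Proof. by move=> f g h; apply: quot_hom_ext => x; apply: addrA. Qed.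
Fact quot_hom_addC : commutative quot_hom_add.
Proof. by move=> f g; apply: quot_hom_ext => x; apply: addrC. Qed.
Fact quot_hom_add0 : left_id quot_hom_zero quot_hom_add.
Proof. by move=> f; apply: quot_hom_ext => x; apply: add0r. Qed.
Fact quot_hom_addN : left_inverse quot_hom_zero quot_hom_opp quot_hom_add.
Proof. by move=> f; apply: quot_hom_ext => x; apply: addNr. Qed.

HB.instance Definition _ := GRing.isZmodule.Build H
  quot_hom_addA quot_hom_addC quot_hom_add0 quot_hom_addN.

Fact quot_hom_scaleA c d f :
  quot_hom_scale c (quot_hom_scale d f) = quot_hom_scale (c * d) f.
Proof.
by apply: quot_hom_ext => x /=; rewrite [c * d]mulrC rmorphM -mulrA.
Qed.
Fact quot_hom_scale1 : left_id 1 quot_hom_scale.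
Proof. by move=> f; apply: quot_hom_ext => x /=; rewrite rmorph1 mul1r. Qed.
Fact quot_hom_scaleDr : right_distributive quot_hom_scale +%R.
Proof. by move=> c f g; apply: quot_hom_ext => x. Qed.
Fact quot_hom_scaleDl f : {morph quot_hom_scale^~ f : c d / c + d}.
Proof.
by move=> c d; apply: quot_hom_ext => x /=; rewrite rmorphD mulrDl quot_homD.
Qed.

HB.instance Definition _ := GRing.Zmodule_isLmodule.Build A H
  quot_hom_scaleA quot_hom_scale1 quot_hom_scaleDr quot_hom_scaleDl.

(* Pointwise convergence with M discrete. On a Tate module and on              *)
(* Hom_Fq(Kq/Aq, Fq) this is the profinite topology: the inverse limit over n  *)
(* of the finite groups Hom(m^-n/Aq, M), with m the maximal ideal of Aq.       *)
HB.instance Definition _ := Topological.copy H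
  (initial_topology (@quot_hom_fun _ _ _ r e M :
     H -> {ptws K -> discrete_topology M})).

Definition quot_hom_comp (u : {linear M -> M}) (f : H) : H.
Proof.
exists (fun x => u (f x)) => *.
- by rewrite quot_homD linearD.
- by rewrite quot_hom_int linear0.
- by rewrite quot_homZ linearZ.
Defined.

End QuotHom.

(* The value at 0 is a placeholder for +oo; [val_ge v n x] is v(x) >= n.       *)
Record discrete_valuation (F : fieldType) := DiscreteValuation {
  dval :> F -> int;
  dval0 : dval 0 = 0;
  dvalM : forall x y, x != 0 -> y != 0 -> dval (x * y) = dval x + dval y;
  dvalD : forall x y, x != 0 -> y != 0 -> x + y != 0 ->
    Num.min (dval x) (dval y) <= dval (x + y);
  dval_onto : exists2 x, x != 0 & dval x = 1
}.

Definition val_ge (F : fieldType) (v : discrete_valuation F) (n : int) (x : F) :=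
  (x == 0) || (n <= v x).

(* K is a finite extension of the field of rational functions Fq(t). *)
Definition function_field (Fq : finFieldType) (K : fieldType)
    (k : {rmorphism Fq -> K}) : Prop :=
  exists2 t : K, ~ algebraicOver k t &
  exists (n : nat) (b : 'I_n -> K), forall f : K,
  exists (g : {poly Fq}) (c : 'I_n -> {poly Fq}), g != 0 /\
    (map_poly k g).[t] * f = \sum_(i < n) (map_poly k (c i)).[t] * b i.

(* A nonsingular projective curve X over Fq is given by its function field K;  *)
(* its closed points are the normalized discrete valuations of K, which are    *)
(* all trivial on the finite field Fq. A function is regular on X - {oo} when  *)
(* it has no pole at any closed point other than oo.                           *)
Record regular_ring (Fq : finFieldType) (A : comAlgType Fq) (K : fieldType)
    (i : {rmorphism A -> K}) (oo : discrete_valuation K) : Prop := RegularRing {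
  regular_curve : function_field (i \o GRing.in_alg A);
  regular_inj : injective i;
  regularP : forall f : K, (exists a, i a = f) <->
    (forall P : discrete_valuation K, ~ (P =1 oo) -> val_ge P 0 f);
  regular_frac : forall f : K, exists a b, b != 0 /\ f = i a / i b
}.

Fixpoint ideal_power (A : comNzRingType) (I : {pred A}) (n : nat) (x : A) : Prop :=
  if n is m.+1 then
    exists s : seq (A * A), (forall ab, ab \in s -> ab.1 \in I /\ ideal_power I m ab.2)
      /\ x = \sum_(ab <- s) ab.1 * ab.2
  else True.

(* Kq is the completion of K for the valuation of the prime q, which on A is   *)
(* given by v(a) >= n iff a is in q^n; Aq is the completion of A, realized as  *)
(* the valuation ring of Kq.                                                   *)
Record completion_at (A : comNzRingType) (K : fieldType) (i : {rmorphism A -> K})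
    (q : {pred A}) (Aq : comNzRingType) (Kq : fieldType)
    (j : {rmorphism A -> Aq}) (k : {rmorphism K -> Kq})
    (e : {rmorphism Aq -> Kq}) (v : discrete_valuation Kq) : Prop := CompletionAt {
  completion_comm : forall a, k (i a) = e (j a);
  completion_val : forall a (n : nat), val_ge v n (k (i a)) <-> ideal_power q n a;
  completion_dense : forall (x : Kq) (n : nat), exists y, val_ge v n (x - k y);
  completion_complete : forall u : nat -> Kq,
    (forall n : nat, exists N, forall m m', (N <= m)%N -> (N <= m')%N ->
       val_ge v n (u m - u m')) ->
    exists l, forall n : nat, exists N, forall m, (N <= m)%N -> val_ge v n (u m - l);
  completion_int_inj : injective e;
  completion_int : forall x, (exists c, e c = x) <-> val_ge v 0 x;
  completion_int_dense : forall (c : Aq) (n : nat), exists a, val_ge v n (e (c - j a))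
}.

Notation tate phi emb j e := (quot_hom j e (drinfeld_points phi emb)).
Notation tate_adjoint phi emb j e := (quot_hom j e (adjoint_points phi emb)).
Notation residue_dual Fq A j e := (quot_hom (j \o GRing.in_alg A) e Fq^o).

Section TateGalois.
Variables (Fq : finFieldType) (A : comAlgType Fq) (L : fieldType).
Variables (Lbar : closedFieldType) (iota : {rmorphism A -> L}).
Variables (phi : drinfeld_module iota) (emb : {rmorphism L -> Lbar}).
Variables (Aq : comNzRingType) (Kq : fieldType) (j : {rmorphism A -> Aq}).
Variables (e : {rmorphism Aq -> Kq}) (sigma : galois_aut emb).

Definition tate_galois : tate phi emb j e -> tate phi emb j e :=
  quot_hom_comp (galois_drinfeld (phi := phi) sigma).
Definition tate_adjoint_galois :
    tate_adjoint phi emb j e -> tate_adjoint phi emb j e :=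
  quot_hom_comp (galois_adjoint (phi := phi) sigma).

End TateGalois.

(* The maps U -> Hom_S(V, W) and V -> Hom_S(U, W) induced by a bilinear B are  *)
(* bijective.                                                                  *)
Definition perfect_pairing (S : comNzRingType) (U V W : lmodType S)
    (B : U -> V -> W) : Prop :=
  (forall g : {linear V -> W}, exists! u, forall v, B u v = g v) /\
  (forall g : {linear U -> W}, exists! v, forall u, B u v = g u).

(* Main.v *)
(* Choose a in A with v_q(a) = 1 and iota(a) <> 0. An element of Hom_A(Kq/Aq, M) *)
(* is then a sequence of elements u_n of M[q^n] with a u_(n+1) = u_n. As M[a^n]   *)
(* is finite for both modules, Nakayama's lemma gives an element of 1 + q^n that  *)
(* projects M[a^n] onto M[q^n]; no factorization theory of A is needed.           *)
(*   For f in L{tau} the form y f(x) - f^*(y) x equals P^q - P for an explicit    *)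
(* biadditive P(f; x, y), so P takes values in Fq on ker f x ker f^*. This finite *)
(* pairing is nondegenerate because an additive polynomial of degree at most      *)
(* q^(d-1) cannot vanish on the q^d elements of ker f. A cocycle identity for     *)
(* P(f g; x, y) makes the pairings for f = phi_(a^n) compatible in n and balanced *)
(* over A, and they assemble to the pairing of Tate modules.                      *)
(*   For the residue dual, a functional chi on Kq that vanishes on Aq but not at  *)
(* the inverse of the uniformizer is a generator: expand a functional digit by    *)
(* digit. This uses that A/q is finite, which follows by comparing the growth of  *)
(* the spaces spanned by the a^i u_l with the degree filtration of K over Fq(t).  *)

Require Import Defs.
From HB Require Import structures.
From mathcomp Require Import all_boot all_order all_algebra all_field.
From mathcomp Require Import all_classical topology.
From mathcomp Require Import ring.

Set Implicit Arguments.
Unset Strict Implicit.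
Unset Printing Implicit Defensive.

Import GRing.Theory.
Local Open Scope classical_set_scope.
Local Open Scope ring_scope.

(** The kernels of an operator f in L{tau} and of its adjoint are finite and dual to each other.
    Green's identity ([green_identity]) writes y f(x) minus x times the adjoint value at y as P^q -
    P, so the biadditive form P = [green emb f x y] is fixed by Frobenius on the two kernels and
    lies in Fq there. With one argument fixed, P becomes an additive polynomial of too small a
    degree to vanish on a whole kernel ([green_nondegr], [green_nondegl]). For f = [phi (a ^+ n)]
    this pairs the a^n-torsion of the two modules, and the product rule [greenM] gives balancedness
    over A and compatibility between levels.

    The element a generates the maximal ideal of [Aq] but may lie in other primes of A, so
    a^n-torsion can exceed q^n-torsion; [tors_projector] cuts it down. A homomorphism from Kq/Aq
    amounts to its values at the a^-n ([tate_eq], [tate_build], [tate_surj]). This glues the finite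
    pairings ([tate_pairing_fun]), and perfectness comes from duality of finite Fq-spaces at each
    level ([pairing_inj], [pairing_repr]).

    For the residue dual, a functional chi with chi(a^-1) = 1 is a generator: modulo a every
    functional is a multiple of chi ([residue_dual_step]), because A/q is finite, and completeness
    sums the resulting digits ([residue_dual_free]). *)

Section Functionals.
(* [comb c x y] stands for c x + y *)
Variables (F : fieldType) (V : Type) (comb : F -> V -> V -> V).
Implicit Types (P : V -> Prop) (g h : V -> F).

Definition comb_closed P := forall c x y, P x -> P y -> P (comb c x y).

Definition linear_on P g :=
  forall c x y, P x -> P y -> g (comb c x y) = c * g x + g y.

Lemma functional_span P (I : eqType) (hs : seq I) (h : I -> V -> F) g :
  comb_closed P -> (forall i, i \in hs -> linear_on P (h i)) -> linear_on P g ->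
  (forall x, P x -> (forall i, i \in hs -> h i x = 0) -> g x = 0) ->
  exists c : I -> F, forall x, P x -> g x = \sum_(i <- undup hs) c i * h i x.
Proof.
have [r rhs ur] : exists2 r, r =i hs & undup hs = r /\ uniq r.
  by exists (undup hs); [apply: mem_undup|split=> //; apply: undup_uniq].
case: ur => -> ur cP lh lg H.
have {}lh i : i \in r -> linear_on P (h i) by rewrite rhs; apply: lh.
have {H} : forall x, P x -> (forall i, i \in r -> h i x = 0) -> g x = 0.
  by move=> x Px hx; apply: H => // i; rewrite -rhs; apply: hx.
elim: r {rhs} ur P cP g lh lg => [|i r IH] /= ur P cP g lh lg gP.
  by exists (fun=> 0) => x Px; rewrite big_nil; apply: gP.
case/andP: ur => ir ur.
have hi : linear_on P (h i) by apply: lh; rewrite mem_head.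
have hr l : l \in r -> linear_on P (h l) by move=> lr; apply: lh; rewrite inE lr orbT.
pose P' x := P x /\ h i x = 0.
have PP' x : P' x -> P x by case.
have cP' : comb_closed P'.
  move=> c x y [Px hx] [Py hy].
  by split; [apply: cP|rewrite hi // hx hy mulr0 addr0].
have [| | |c cE] := IH ur P' cP' g.
- by move=> l lr d x y /PP' Px /PP' Py; apply: hr.
- by move=> d x y /PP' Px /PP' Py; apply: lg.
- move=> x [Px hx] H; apply: gP => // l; rewrite inE => /predU1P[->//|].
  exact: H.
pose g' x := g x - \sum_(l <- r) c l * h l x.
have lg' : linear_on P g'.
  move=> d x y Px Py; rewrite /g' lg //.
  rewrite big_seq (eq_bigr (fun l => d * (c l * h l x) + c l * h l y)) -?big_seq.
    by rewrite big_split -mulr_sumr /= opprD mulrBr addrACA.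
  by move=> l lr; rewrite hr // mulrDr mulrCA.
have sum_c d x : \sum_(l <- i :: r) (if l == i then d else c l) * h l x
    = d * h i x + \sum_(l <- r) c l * h l x.
  rewrite big_cons eqxx; congr (_ + _); apply: eq_big_seq => l lr.
  by case: eqP => // li; rewrite -li lr in ir.
have [[x0 [Px0 hx0]]|H] := pselect (exists x0, P x0 /\ h i x0 != 0); last first.
  exists (fun l => if l == i then 0 else c l) => x Px.
  rewrite sum_c mul0r add0r; apply: cE; split=> //.
  by apply: contrapT => /eqP hx; apply: H; exists x.
exists (fun l => if l == i then g' x0 / h i x0 else c l) => x Px.
rewrite sum_c; apply/eqP; rewrite -subr_eq; apply/eqP.
change (g' x = g' x0 / h i x0 * h i x).
(* Corrected by this multiple of x0, x falls into the kernel of [h i], where the induction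
   hypothesis applies. *)
pose d := - (h i x / h i x0).
have Py : P (comb d x0 x) by apply: cP.
have : g' (comb d x0 x) = 0.
  rewrite /g' cE ?subrr //; split=> //.
  by rewrite hi // mulNr divfK // addNr.
rewrite lg' // => /eqP; rewrite addrC addr_eq0 => /eqP ->.
by rewrite mulNr opprK mulrC mulrA mulrAC.
Qed.

End Functionals.

(** * Homomorphisms from Kq/Aq *)

Section Tate.
Variables (A Aq : comNzRingType) (Kq : fieldType).
Variables (j : {rmorphism A -> Aq}) (e : {rmorphism Aq -> Kq}) (a : A).
Local Notation w := (e (j a)).

(* [adiv n b] says that b lies in the n-th power of the prime q *)
Definition adiv n b := exists c, j b = j a ^+ n * c.

(** What the Tate modules need from the completion. [unif_power] says that q^(n+1) is generated by
    products from q and q^n; finite sums are expressed as induction over additively closed [Q]. *)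
Record uniformizer : Prop := Uniformizer {
  unif_neq0 : w != 0;
  unif_inj : injective e;
  unif_denom : forall x, exists n c, w ^+ n * x = e c;
  unif_dense : forall c n, exists b c', c = j b + j a ^+ n * c';
  unif_power : forall n b, adiv n.+1 b -> forall Q : A -> Prop,
    Q 0 -> (forall x y, Q x -> Q y -> Q (x + y)) ->
    (forall x y, adiv 1 x -> adiv n y -> Q (x * y)) -> Q b
}.

Hypothesis hU : uniformizer.
Let w0 := unif_neq0 hU.

Let wn0 n : w ^+ n != 0. Proof. by rewrite expf_neq0. Qed.

Lemma adiv0 n : adiv n 0.
Proof. by exists 0; rewrite rmorph0 mulr0. Qed.
Lemma adivD n b b' : adiv n b -> adiv n b' -> adiv n (b + b').
Proof. by move=> [c hc] [c' hc']; exists (c + c'); rewrite rmorphD hc hc' mulrDr. Qed.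
Lemma adivN n b : adiv n b -> adiv n (- b).
Proof. by move=> [c hc]; exists (- c); rewrite rmorphN hc mulrN. Qed.
Lemma adivMl n b d : adiv n b -> adiv n (d * b).
Proof. by move=> [c hc]; exists (j d * c); rewrite rmorphM hc mulrCA. Qed.
Lemma adivM n m b d : adiv n b -> adiv m d -> adiv (n + m) (b * d).
Proof.
move=> [c hc] [c' hc']; exists (c * c').
by rewrite rmorphM hc hc' exprD mulrACA.
Qed.
Lemma adivXn n b : adiv 1 b -> adiv n (b ^+ n).
Proof.
move=> hb; elim: n => [|n IH]; first by exists 1; rewrite rmorph1 mulr1.
by rewrite exprS -add1n; apply: adivM.
Qed.
Lemma adiv_a n : adiv n (a ^+ n).
Proof. by exists 1; rewrite rmorphXn mulr1. Qed.

(** Modulo [Aq], x equals b / a^n with b in A itself: clear the denominator, then use density. Hence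
    maps out of Kq/Aq that are only A-linear are determined by their values at the [w ^- n]. *)
Lemma unif_repr x : exists n b c, w ^+ n * x = e (j b + j a ^+ n * c).
Proof.
have [n [c hc]] := unif_denom hU x; have [b [c' hc']] := unif_dense hU c n.
by exists n, b, c'; rewrite hc hc'.
Qed.

Lemma unif_raise n k b c x : w ^+ n * x = e (j b + j a ^+ n * c) ->
  w ^+ (k + n) * x = e (j (a ^+ k * b) + j a ^+ (k + n) * c).
Proof.
move=> h; rewrite exprD -mulrA h -rmorphXn -rmorphM; congr (e _).
by rewrite mulrDr rmorphM rmorphXn exprD mulrA.
Qed.

Lemma unif_repr2 x y : exists n b c b' c', w ^+ n * x = e (j b + j a ^+ n * c)
  /\ w ^+ n * y = e (j b' + j a ^+ n * c').
Proof.
have [n [b [c h]]] := unif_repr x; have [n' [b' [c' h']]] := unif_repr y.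
exists (n' + n)%N, (a ^+ n' * b), c, (a ^+ n * b'), c'.
by split; [apply: unif_raise|rewrite addnC; apply: unif_raise].
Qed.

Lemma unif_unique n b c b' c' x : w ^+ n * x = e (j b + j a ^+ n * c) ->
  w ^+ n * x = e (j b' + j a ^+ n * c') -> adiv n (b - b').
Proof.
move=> -> /(unif_inj hU) h; exists (c' - c).
by rewrite rmorphB mulrBr -(addrK (j a ^+ n * c) (j b)) h; ring.
Qed.

Section Module.
Variable M : lmodType A.
Local Notation T := (quot_hom j e M).

Definition tors n (m : M) := forall b, adiv n b -> b *: m = 0.

Lemma tors0 n : tors n 0.
Proof. by move=> b _; rewrite scaler0. Qed.
Lemma torsD n m m' : tors n m -> tors n m' -> tors n (m + m').
Proof. by move=> h h' b hb; rewrite scalerDr h // h' // addr0. Qed.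
Lemma torsZ n c m : tors n m -> tors n (c *: m).
Proof. by move=> h b hb; rewrite scalerA mulrC -scalerA h // scaler0. Qed.
Lemma tors_a n m : tors n m -> a ^+ n *: m = 0.
Proof. by apply; apply: adiv_a. Qed.
Lemma tors_eq n b b' m : tors n m -> adiv n (b - b') -> b *: m = b' *: m.
Proof.
by move=> h hb; apply/eqP; rewrite -subr_eq0 -scalerBl; apply/eqP; apply: h.
Qed.

Lemma tate_int (t : T) x n c : w ^+ n * x = e c -> tors n (t x).
Proof.
move=> h b [c' hc']; rewrite -quot_homZ hc' rmorphM rmorphXn mulrAC h -rmorphM.
by rewrite quot_hom_int.
Qed.

Lemma tate_tors (t : T) n : tors n (t (w ^- n)).
Proof. by apply: (@tate_int _ _ _ 1); rewrite divff ?rmorph1. Qed.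

Lemma tate_val (t : T) x n b c : w ^+ n * x = e (j b + j a ^+ n * c) ->
  t x = b *: t (w ^- n).
Proof.
move=> h; have -> : x = e (j b) * w ^- n + e c.
  apply: (mulfI (wn0 n)); rewrite h mulrDr mulrCA divff // mulr1.
  by rewrite rmorphD rmorphM rmorphXn.
by rewrite quot_homD quot_hom_int addr0 quot_homZ.
Qed.

Lemma tate_eq (t t' : T) : (forall n, t (w ^- n) = t' (w ^- n)) -> t = t'.
Proof.
move=> h; apply: quot_hom_ext => x; have [n [b [c hx]]] := unif_repr x.
by rewrite !(tate_val _ hx) h.
Qed.

(** The quotient is x -> t(a^-n x). It kills [Aq] because an element of [Aq] is congruent modulo a^n
    to some b in A, so the value is b t(a^-n) = 0. *)
Lemma tate_div (t : T) n : t (w ^- n) = 0 -> exists t' : T, t = j a ^+ n *: t'.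
Proof.
move=> t0; unshelve eexists.
  exists (fun x => t (w ^- n * x)).
  - by move=> x y; rewrite mulrDr quot_homD.
  - move=> c; have [b [c' hc]] := unif_dense hU c n.
    rewrite (@tate_val t _ n b c') ?t0 ?scaler0 //.
    by rewrite mulrA divff // mul1r hc.
  - by move=> b x; rewrite mulrCA quot_homZ.
by apply: quot_hom_ext => x /=; rewrite rmorphXn mulrA mulVf // mul1r.
Qed.

Section Build.
Variable u : nat -> M.
Hypotheses (u_tors : forall n, tors n (u n)) (u_succ : forall n, a *: u n.+1 = u n).

Let u_add k n : a ^+ k *: u (k + n)%N = u n.
Proof.
by elim: k => [|k IH]; rewrite ?expr0 ?scale1r // addSn exprSr -scalerA u_succ.
Qed.

(** A-linearity forces the value b u_n at b / a^n; two representations are compared by raising both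
    to a common level. *)
Let graph x m := exists n b c, w ^+ n * x = e (j b + j a ^+ n * c) /\ m = b *: u n.

Let graph_unique x m m' : graph x m -> graph x m' -> m = m'.
Proof.
move=> [n [b [c [h ->]]]] [n' [b' [c' [h' ->]]]].
rewrite -(u_add n' n) -(u_add n n') !scalerA [(n + n')%N]addnC.
rewrite -(mulrC (a ^+ n')) -(mulrC (a ^+ n)).
have h2 := unif_raise n h'; rewrite addnC in h2.
have h3 := unif_unique (unif_raise n' h) h2.
exact: tors_eq (@u_tors (n' + n)%N) h3.
Qed.

Let fn x := xget 0 [set m | graph x m].

Let fnP n b c x : w ^+ n * x = e (j b + j a ^+ n * c) -> fn x = b *: u n.
Proof.
move=> h; have gx : graph x (b *: u n) by exists n, b, c.
exact: graph_unique (xgetPex 0 (ex_intro (graph x) _ gx)) gx.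
Qed.

Lemma tate_build : exists t : T, forall n, t (w ^- n) = u n.
Proof.
unshelve eexists; first exists fn.
- move=> x y; have [n [b [c [b' [c' [h h']]]]]] := unif_repr2 x y.
  rewrite (fnP h) (fnP h') -scalerDl; apply: (@fnP _ _ (c + c')).
  by rewrite mulrDr h h'; ring.
- move=> c; rewrite (@fnP 0 0 c); first by rewrite scale0r.
  by rewrite !expr0 !mul1r rmorph0 add0r.
- move=> b x; have [n [b' [c h]]] := unif_repr x.
  rewrite (fnP h) scalerA; apply: (@fnP _ _ (j b * c)).
  by rewrite mulrCA h; ring.
move=> n /=; rewrite (@fnP n 1 0) ?scale1r //.
by rewrite divff // mulr0 addr0 !rmorph1.
Qed.

End Build.

(** Generators are eliminated one at a time instead of by a determinant: a factor 1 - eps maps Y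
    into the span of an ever shorter list, finally into 0. *)
Lemma nakayama (Y : M -> Prop) (ys : seq M) :
  (forall y, y \in ys -> Y y) -> (forall y, Y y -> y \in ys) ->
  (forall y, Y y -> forall Q : M -> Prop, Q 0 ->
     (forall x y, Q x -> Q y -> Q (x + y)) ->
     (forall x y, adiv 1 x -> Y y -> Q (x *: y)) -> Q y) ->
  exists2 eps, adiv 1 eps & forall y, Y y -> (1 - eps) *: y = 0.
Proof.
move=> ysY Yys Yind.
pose fix span (s : seq M) (z : M) {struct s} : Prop :=
  if s is y :: s' then exists d, span s' (z - d *: y) else z = 0.
have span0 s : span s 0.
  by elim: s => //= y s IH; exists 0; rewrite scale0r subr0.
have spanD s x z : span s x -> span s z -> span s (x + z).
  elim: s x z => [|y s IH] x z /=; first by move=> -> ->; rewrite addr0.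
  by move=> [d hd] [d' hd']; exists (d + d'); rewrite scalerDl opprD addrACA; apply: IH.
have spanZ s c x : span s x -> span s (c *: x).
  elim: s x => [|y s IH] x /=; first by move=> ->; rewrite scaler0.
  by move=> [d hd]; exists (c * d); rewrite -scalerA -scalerBr; apply: IH.
suff key s : (forall y, y \in s -> Y y) -> forall eps, adiv 1 eps ->
    (forall z, Y z -> span s ((1 - eps) *: z)) ->
    exists2 eps, adiv 1 eps & forall y, Y y -> (1 - eps) *: y = 0.
  apply: (key _ ysY 0 (adiv0 _)) => z /Yys; rewrite subr0 scale1r.
  elim: {key ysY Yys} ys => //= y s IH; rewrite inE => /predU1P[->|zs].
    by exists 1; rewrite scale1r subrr.
  by exists 0; rewrite scale0r subr0; apply: IH.
elim: s => [|y s IH] sY eps eps1 hspan; first by exists eps.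
pose Q z := exists2 c, adiv 1 c & span s ((1 - eps) *: z - c *: y).
have [||x z [c hc hs] [c' hc' hs']|x z hx hz|c c1 hc] := Yind y _ Q.
- by apply: sY; rewrite mem_head.
- by exists 0; [apply: adiv0|rewrite scaler0 scale0r subr0].
- exists (c + c'); first exact: adivD.
  by rewrite scalerDr [(c + c') *: y]scalerDl opprD addrACA; apply: spanD.
- have [d hd] := hspan z hz; exists (d * x); first exact: adivMl.
  rewrite scalerA mulrC -scalerA [d * x]mulrC -scalerA -scalerBr; exact: spanZ.
(* Modulo the span of [s], (1 - eps) y equals c y, so 1 - eps - c sends y into that span; 1 - eps'
   is its product with 1 - eps. *)
pose eps' := eps + (1 - eps) * (eps + c).
have eps'E : 1 - eps' = (1 - eps - c) * (1 - eps).
  by rewrite /eps'; ring.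
apply: (IH _ eps').
- by move=> z zs; apply: sY; rewrite inE zs orbT.
- by rewrite /eps'; apply: adivD => //; apply: adivMl; apply: adivD.
move=> z hz; have [d hd] := hspan z hz; rewrite eps'E -scalerA.
rewrite -[(1 - eps) *: z](subrK (d *: y)) scalerDr; apply: spanD.
  exact: spanZ.
by rewrite scalerA mulrC -scalerA; apply: spanZ; rewrite scalerBl.
Qed.

Hypothesis finM : forall n, exists s : seq M, forall m, a ^+ n *: m = 0 -> m \in s.

(* On the a^n-torsion every element of q^n acts as one of q^(n+1), so          *)
(* Nakayama's lemma applies to the finite module q^n M[a^n].                   *)
Lemma tors_projector n : exists2 h, adiv n (1 - h) &
  forall m, a ^+ n *: m = 0 -> tors n (h *: m).
Proof.
pose Y (z : M) := forall Q : M -> Prop, Q 0 ->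
  (forall x y, Q x -> Q y -> Q (x + y)) ->
  (forall b m, adiv n b -> a ^+ n *: m = 0 -> Q (b *: m)) -> Q z.
have Ya z : Y z -> a ^+ n *: z = 0.
  move=> hz; apply: (hz (fun z => a ^+ n *: z = 0)) => [|x y hx hy|b m _ hm].
  - by rewrite scaler0.
  - by rewrite scalerDr hx hy addr0.
  by rewrite scalerA mulrC -scalerA hm scaler0.
have [s hs] := finM n.
have [|||eps eps1 heps] := @nakayama Y [seq m <- s | `[< Y m >]].
- by move=> y; rewrite mem_filter => /andP[/asboolP].
- move=> y hy; rewrite mem_filter.
  by apply/andP; split; [apply/asboolP|apply/hs/Ya].
- move=> y hy Q Q0 QD QM; apply: hy => // b m hb hm.
  have [c hc] := hb; have [d [c' hd]] := unif_dense hU c 1.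
  (* Since a^n kills m, b may be changed by a multiple of a^n; d is chosen so that the difference
     lies in q^(n+1). *)
  have -> : b *: m = (b - a ^+ n * d) *: m.
    by rewrite scalerBl [a ^+ n * d]mulrC -scalerA hm scaler0 subr0.
  have hb' : adiv n.+1 (b - a ^+ n * d).
    exists c'; rewrite rmorphB rmorphM rmorphXn hc -mulrBr hd addrC addKr mulrA.
    by rewrite expr1 -exprSr.
  apply: (unif_power hU hb' (Q := fun b => Q (b *: m))); first by rewrite scale0r.
    by move=> x z hx hz; rewrite scalerDl; apply: QD.
  move=> x z hx hz; rewrite -scalerA; apply: QM => // R R0 RD RM; exact: RM.
(* The power eps^n lies in q^n, while 1 - eps^n is a multiple of 1 - eps, which kills q^n M[a^n]. *)
exists (1 - eps ^+ n); first by rewrite opprB addrC subrK; apply: adivXn.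
move=> m hm b hb; rewrite -{1}(expr1n A n) subrXX; set g := \sum_(_ < _) _.
have -> : b *: (((1 - eps) * g) *: m) = g *: ((1 - eps) *: (b *: m)).
  by rewrite !scalerA; congr (_ *: _); ring.
by rewrite heps ?scaler0 // => Q Q0 QD QM; apply: QM.
Qed.

Hypothesis divM : forall m : M, exists m', a *: m' = m.

(** Divide m by a in M, then apply the projector h of level n + 1: it is congruent to 1 modulo
    q^(n+1), so it fixes m and keeps the division valid. *)
Lemma tors_lift n m : tors n m -> exists m', tors n.+1 m' /\ a *: m' = m.
Proof.
move=> hm; have [m' hm'] := divM m; have [h h1 hh] := tors_projector n.+1.
exists (h *: m'); split; first by apply: hh; rewrite exprSr -scalerA hm' tors_a.
rewrite scalerA mulrC -scalerA hm' -[RHS]scale1r; apply: tors_eq hm _.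
have [c hc] := adivN h1; exists (j a * c).
by rewrite -opprB hc exprSr mulrA.
Qed.

Lemma tate_surj n m : tors n m -> exists t : T, t (w ^- n) = m.
Proof.
move=> hm.
have step (k : nat) (x : {x : M | tors (n + k) x}) :
    {y : {x : M | tors (n + k.+1) x} | a *: sval y = sval x}.
  apply: cid; have [m' [h1 h2]] := tors_lift (svalP x).
  by rewrite -addnS in h1; exists (exist _ m' h1).
have hm0 : tors (n + 0) m by rewrite addn0.
pose fix vv k : {x : M | tors (n + k) x} :=
  if k is k'.+1 then sval (step k' (vv k')) else exist _ m hm0.
have vS k : a *: sval (vv k.+1) = sval (vv k) by apply: (svalP (step k (vv k))).
have vm k : a ^+ k *: sval (vv k) = m.
  by elim: k => [|k IH]; rewrite ?expr0 ?scale1r // exprSr -scalerA vS.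
(* The lift [vv k] has level n + k; multiplication by a^n brings it to level k, and gives m at k =
   n. *)
have [||t ht] := @tate_build (fun k => a ^+ n *: sval (vv k)).
- move=> k b hb; rewrite scalerA mulrC; apply: (svalP (vv k)).
  by apply: adivM => //; apply: adiv_a.
- by move=> k; rewrite scalerA mulrC -scalerA vS.
by exists t; rewrite ht vm.
Qed.

End Module.

End Tate.

(** * Perfectness from nondegenerate pairings on torsion *)

Section PerfectHalf.
Variables (Fq : finFieldType) (A : comAlgType Fq) (Aq : comNzRingType).
Variables (Kq : fieldType) (j : {rmorphism A -> Aq}) (e : {rmorphism Aq -> Kq}).
Variable a : A.
Local Notation w := (e (j a)).
Local Notation W := (residue_dual Fq A j e).

(** The conditions bear only on a^n-torsion. Additivity and nondegeneracy concern the second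
    argument, so the record is used once for p and once for p with its arguments exchanged. *)
Record torsion_pairing (M N : lmodType A) (p : nat -> M -> N -> Fq) : Prop :=
    TorsionPairing {
  tp_addr : forall n x y z, a ^+ n *: x = 0 -> a ^+ n *: y = 0 ->
    a ^+ n *: z = 0 -> p n x (y + z) = p n x y + p n x z;
  tp_scale : forall n l x y, a ^+ n *: x = 0 -> a ^+ n *: y = 0 ->
    p n (l%:A *: x) y = l * p n x y;
  tp_bal : forall n c x y, a ^+ n *: x = 0 -> a ^+ n *: y = 0 ->
    p n (c *: x) y = p n x (c *: y);
  tp_level : forall m n x y, a ^+ (m + n) *: x = 0 -> a ^+ n *: y = 0 ->
    p (m + n)%N x y = p n (a ^+ m *: x) y;
  tp_nondeg : forall n y, a ^+ n *: y = 0 ->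
    (forall x, a ^+ n *: x = 0 -> p n x y = 0) -> y = 0
}.

Hypothesis hU : uniformizer j e a.
Let w0 := unif_neq0 hU.
Let wn0 n : w ^+ n != 0. Proof. by rewrite expf_neq0. Qed.

Section Pair.
Variables (M N : lmodType A) (p : nat -> M -> N -> Fq).
Hypotheses (hp : torsion_pairing p) (hp' : torsion_pairing (fun n x y => p n y x)).
Hypothesis finM : forall n, exists s : seq M, forall m, a ^+ n *: m = 0 -> m \in s.
Hypothesis finN : forall n, exists s : seq N, forall m, a ^+ n *: m = 0 -> m \in s.
Hypothesis divN : forall m : N, exists m', a *: m' = m.

Local Notation TM := (quot_hom j e M).
Local Notation TN := (quot_hom j e N).

(** The projector h fixes y, so p(x, y) = p(x, h y) = p(h x, y) with h x in M[q^n]. *)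
Lemma tors_nondeg n (y : N) : tors j a n y ->
  (forall x : M, tors j a n x -> p n x y = 0) -> y = 0.
Proof.
move=> hy H; have ya := tors_a hy.
apply: (tp_nondeg hp ya) => x hx.
have [h h1 hh] := tors_projector hU finM n.
have <- : h *: y = y.
  by rewrite -[RHS]scale1r; apply: (tors_eq hy); rewrite -opprB; apply: adivN.
by rewrite -(tp_bal hp) //; apply: H; apply: hh.
Qed.

Lemma tp_subl n x x' y : a ^+ n *: x = 0 -> a ^+ n *: x' = 0 ->
  a ^+ n *: y = 0 -> p n (x - x') y = p n x y - p n x' y.
Proof.
move=> hx hx' hy; rewrite (tp_addr hp') ?scalerN ?hx' ?oppr0 //; congr (_ + _).
by rewrite -scaleN1r -[-1](scaleN1r (1 : A)) (tp_scale hp) // mulN1r.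
Qed.

(** The functionals p(x, -) for x in the finite set M[q^n] have only 0 as common zero on N[q^n], so
    they span its dual by [functional_span]; a combination of them is again some p(x, -). *)
Lemma torsion_functional n (gam : N -> Fq) :
  (forall l y z, tors j a n y -> tors j a n z ->
     gam (l%:A *: y + z) = l * gam y + gam z) ->
  exists x : M, tors j a n x /\ forall y, tors j a n y -> p n x y = gam y.
Proof.
move=> gamP; have [S hS] := finM n.
pose X := [seq x <- S | `[< tors j a n x >]].
have XP x : x \in X <-> tors j a n x.
  rewrite mem_filter; split=> [/andP[/asboolP]//|hx].
  by apply/andP; split; [apply/asboolP|apply: hS; apply: tors_a hx].
have pD x y z l : tors j a n x -> tors j a n y -> tors j a n z ->
    p n x (l%:A *: y + z) = l * p n x y + p n x z.
  move=> hx hy hz; have := torsZ l%:A hy => hly.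
  rewrite (tp_addr hp) ?(tors_a hx) ?(tors_a hly) ?(tors_a hz) //; congr (_ + _).
  by rewrite -(tp_bal hp) ?(tp_scale hp) ?(tors_a hx) ?(tors_a hy).
pose comb (l : Fq) (y z : N) := l%:A *: y + z.
have cP : comb_closed comb (tors j a n).
  by move=> l y z hy hz; apply: torsD => //; apply: torsZ.
have [| | |c cE] := functional_span (h := p n) (hs := X) (g := gam) cP.
- by move=> x /XP hx l y z hy hz; apply: pD.
- by move=> l y z hy hz; apply: gamP.
- move=> y hy hX; suff -> : y = 0.
    have t0 : tors j a n (0 : N) by apply: tors0.
    have := gamP 1 0 0 t0 t0; rewrite scaler0 addr0 mul1r.
    by move/(congr1 (fun z => z - gam 0)); rewrite addrK subrr.
  by apply: (tors_nondeg hy) => x /XP; apply: hX.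
have Xu x : x \in undup X -> tors j a n x by rewrite mem_undup => /XP.
suff [z [zt zE]] : exists z, tors j a n z /\ forall y, tors j a n y ->
    p n z y = \sum_(x <- undup X) c x * p n x y.
  by exists z; split=> // y hy; rewrite cE // zE.
elim: (undup X) Xu => [|x s IH] Xu.
  exists 0; split=> [|y hy]; first exact: tors0.
  rewrite big_nil; have := tp_scale hp 0 (scaler0 _ _) (tors_a hy).
  by rewrite scaler0 mul0r.
have [y ys|z [zt zE]] := IH; first by apply: Xu; rewrite inE ys orbT.
have hx : tors j a n x by apply: Xu; rewrite mem_head.
have hcx := torsZ (c x)%:A hx; exists ((c x)%:A *: x + z); split=> [|y hy].
  exact: torsD.
rewrite big_cons (tp_addr hp') ?(tors_a hcx) ?(tors_a zt) ?(tors_a hy) //.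
by rewrite zE // (tp_scale hp) ?(tors_a hx) ?(tors_a hy).
Qed.

Hypothesis nondeg' : forall n (x : M), tors j a n x ->
  (forall y : N, tors j a n y -> p n x y = 0) -> x = 0.

Variable B : TM -> TN -> W.
Hypothesis BE : forall t s n x c, w ^+ n * x = e c ->
  B t s x = p n (t x) (s (w ^- n)).

(** Writing x as b / a^n modulo [Aq], move b across the balanced pairing. By this symmetry the
    present half of perfectness also applies with the two modules exchanged. *)
Lemma pairing_sym t s n x c : w ^+ n * x = e c ->
  B t s x = p n (t (w ^- n)) (s x).
Proof.
move=> h; rewrite (BE _ _ h); have [b [c' hc]] := unif_dense hU c n.
rewrite hc in h; rewrite !(tate_val hU _ h) (tp_bal hp) //; apply: tors_a.
  exact: tate_tors.
exact: tate_tors.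
Qed.

Lemma pairing_inj (s s' : TN) : (forall n (x : M), tors j a n x ->
    exists t : TM, t (w ^- n) = x) ->
  (forall t, B t s = B t s') -> s = s'.
Proof.
move=> surjM H; apply: (tate_eq hU) => n.
apply/eqP; rewrite -subr_eq0; apply/eqP.
have hint : w ^+ n * w ^- n = e 1 by rewrite divff // rmorph1.
have hs (r : TN) : tors j a n (r (w ^- n)) by apply: tate_tors.
have hN : tors j a n (- s' (w ^- n)) by rewrite -scaleN1r; apply: torsZ.
apply: (@tors_nondeg n); first by apply: torsD.
move=> x /[dup] hx /surjM [t <-].
have ta : a ^+ n *: t (w ^- n) = 0 by apply/tors_a/tate_tors.
have sa (r : TN) : a ^+ n *: r (w ^- n) = 0 by apply/tors_a/tate_tors.
rewrite (tp_addr hp) ?scalerN ?sa ?oppr0 //.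
rewrite -[in X in _ + X]scaleN1r -[-1](scaleN1r (1 : A)).
by rewrite -(tp_bal hp) // (tp_scale hp) // -!(BE _ _ hint) H mulN1r subrr.
Qed.

(** The map g induces a functional on each N[q^n]; these are represented by elements u_n of M[q^n],
    and nondegeneracy forces a u_(n+1) = u_n. *)
Lemma pairing_repr (g : {linear TN -> W}) : exists t, forall s, B t s = g s.
Proof.
have surjN n y := @tate_surj _ _ _ j e a hU N finN divN n y.
have hint n : w ^+ n * w ^- n = e 1 by rewrite divff // rmorph1.

(* If s and s' agree at a^-n they differ by a^n r, and (a^n g(r))(a^-n) = g(r)(1) = 0. *)
have gwd n (s s' : TN) : s (w ^- n) = s' (w ^- n) -> g s (w ^- n) = g s' (w ^- n).
  move=> ss; have : (s - s') (w ^- n) = 0 by rewrite /= ss subrr.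
  move/(tate_div hU) => [r hr].
  have -> : s = s' + j a ^+ n *: r by rewrite -hr addrC subrK.
  by rewrite linearD linearZ /= rmorphXn hint quot_hom_int addr0.
pose lift n y : TN := xget 0 [set s : TN | s (w ^- n) = y].
have liftP n y : tors j a n y -> lift n y (w ^- n) = y.
  by move=> /surjN hy; apply: (xgetPex 0 hy).
pose gam n y := g (lift n y) (w ^- n).
have gamE n (s : TN) : gam n (s (w ^- n)) = g s (w ^- n).
  by apply: gwd; apply: liftP; apply: tate_tors.
have ex_u n : exists x : M, tors j a n x /\ forall y, tors j a n y -> p n x y = gam n y.
  apply: torsion_functional => l y z hy hz.
  rewrite -(liftP _ _ hy) -(liftP _ _ hz).
  have -> : l%:A *: lift n y (w ^- n) + lift n z (w ^- n) =
      (j l%:A *: lift n y + lift n z) (w ^- n) by rewrite /= quot_homZ.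
  rewrite !gamE linearP /=; congr (_ + _).
  exact: (quot_homZ (g (lift n y))).
have [u hu] := choice ex_u.
have [||t ht] := @tate_build _ _ _ j e a hU M u.
- by move=> n; case: (hu n).
- move=> n; have [un Hn] := hu n; have [un1 Hn1] := hu n.+1.
  have hau : tors j a n (a *: u n.+1).
    move=> b hb; rewrite scalerA mulrC; apply: un1; rewrite -add1n.
    by apply: adivM hb; have := @adiv_a _ _ j a 1%N.
  have hau' : tors j a n (a *: u n.+1 - u n).
    by apply: torsD => //; rewrite -scaleN1r; apply: torsZ.
  apply/eqP; rewrite -subr_eq0; apply/eqP; apply: nondeg' hau' _.
  move=> y /[dup] hy /surjN [s sy]; have ya := tors_a hy.
  rewrite tp_subl ?(tors_a hau) ?(tors_a un) // Hn // -{1}[a]expr1.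
  have un1a := tors_a un1; rewrite -add1n in un1a.
  rewrite -(tp_level hp) // -sy gamE.
  have -> : s (w ^- n) = (j a *: s) (w ^- (1 + n)).
    by rewrite /= add1n exprS invfM mulrA divff // mul1r.
  rewrite Hn1 ?gamE; last exact: tate_tors.
  by rewrite linearZ /= exprS invfM mulrA divff // mul1r subrr.
exists t => s; apply: quot_hom_ext => x.
have [n [b [c h]]] := unif_repr hU x.
rewrite (pairing_sym _ _ h) ht (tate_val hU _ h).
have -> : b *: s (w ^- n) = (j b *: s) (w ^- n) by rewrite /= quot_homZ.
have [_ ->] := hu n; last exact: tate_tors.
rewrite gamE linearZ /=.
have -> : x = e (j b) * w ^- n + e c.
  apply: (mulfI (wn0 n)); rewrite h mulrDr mulrCA divff // mulr1.
  by rewrite rmorphD rmorphM rmorphXn.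
by rewrite quot_homD quot_hom_int addr0.
Qed.
End Pair.
End PerfectHalf.

(** * The topology of pointwise convergence *)

Section QuotHomTopology.
Variables (R A : comNzRingType) (K : fieldType) (r : {rmorphism R -> A}).
Variables (e : {rmorphism A -> K}) (M : lmodType R).
Local Notation H := (quot_hom r e M).

Lemma quot_hom_eval_nbhs (f : H) x : nbhs f [set g : H | g x = f x].
Proof.
have c : continuous (@quot_hom_fun _ _ _ r e M :
    H -> {ptws K -> discrete_topology M}) by exact: initial_continuous.
have pc : continuous (fun g : {ptws K -> discrete_topology M} => g x).
  exact: (@proj_continuous K (fun=> discrete_topology M) x).
have := c f; move/(_ ((fun g : {ptws K -> discrete_topology M} => g x) @^-1`
  [set f x])); apply.
exact: pc (discrete_set1 (f x : discrete_topology M)).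
Qed.

Lemma quot_hom_continuous_at (T : topologicalType) (F : T -> H) (t : T) :
  (forall x, nbhs t [set t' | F t' x = F t x]) -> F t' @[t' --> t] --> F t.
Proof.
move=> loc.
have pw : (quot_hom_fun (F t') : {ptws K -> discrete_topology M}) @[t' --> t]
    --> (quot_hom_fun (F t) : {ptws K -> discrete_topology M}).
  apply/cvg_sup => x U [_ [[V Vop <-] Vf sVU]].
  by apply: filterS (loc x) => t' /= E; apply: sVU; rewrite /= E.
move=> U [_ [[V Vop <-] Vf sVU]].
have Vn : nbhs (quot_hom_fun (F t) : {ptws K -> discrete_topology M}) V.
  exact: open_nbhs_nbhs.
have pV : nbhs t [set t' | V (quot_hom_fun (F t'))] := pw V Vn.
have UV : [set t' | V (quot_hom_fun (F t'))] `<=` [set t' | U (F t')].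
  by move=> t' /= Vt'; apply: sVU.
exact: filterS UV pV.
Qed.

End QuotHomTopology.

(** * Gluing the finite pairings *)

Section TatePairing.
Variables (Fq : finFieldType) (A : comAlgType Fq) (Aq : comNzRingType).
Variables (Kq : fieldType) (j : {rmorphism A -> Aq}) (e : {rmorphism Aq -> Kq}).
Variable a : A.
Hypothesis hU : uniformizer j e a.
Local Notation w := (e (j a)).
Local Notation W := (residue_dual Fq A j e).
Let w0 := unif_neq0 hU.
Let wn0 n : w ^+ n != 0. Proof. by rewrite expf_neq0. Qed.

Variables (M N : lmodType A) (p : nat -> M -> N -> Fq).
Hypotheses (hp : torsion_pairing a p).
Hypothesis (hp' : torsion_pairing a (fun n x y => p n y x)).
Hypothesis finM : forall n, exists s : seq M, forall m, a ^+ n *: m = 0 -> m \in s.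
Hypothesis finN : forall n, exists s : seq N, forall m, a ^+ n *: m = 0 -> m \in s.
Hypothesis divM : forall m : M, exists m', a *: m' = m.
Hypothesis divN : forall m : N, exists m', a *: m' = m.

Local Notation TM := (quot_hom j e M).
Local Notation TN := (quot_hom j e N).

Let tate_a (P : lmodType A) (t : quot_hom j e P) n x c :
  w ^+ n * x = e c -> a ^+ n *: t x = 0.
Proof. by move=> h; apply/tors_a/(tate_int _ h). Qed.

Let hint n : w ^+ n * w ^- n = e 1.
Proof. by rewrite divff // rmorph1. Qed.


(** By [tp_level], a^m moves onto the second argument and turns a^-(m+n) into a^-n. Hence the
    arbitrary denominator [den x] chosen below is harmless. *)
Let level_raise (t : TM) (s : TN) m n x c : w ^+ n * x = e c ->
  p (m + n)%N (t x) (s (w ^- (m + n))) = p n (t x) (s (w ^- n)).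
Proof.
move=> h; rewrite (tp_level hp') ?(tate_a _ h) ?(tate_a _ (hint _)) //.
rewrite -quot_homZ rmorphXn rmorphXn; congr (p n _ (s _)).
by rewrite exprD invfM mulrA divff // mul1r.
Qed.

Let den x := xget 0%N [set n | exists c, w ^+ n * x = e c].
Let denP x : exists c, w ^+ den x * x = e c.
Proof.
have [n nP] := unif_denom hU x.
exact: (xgetPex 0%N (ex_intro (fun n => exists c, w ^+ n * x = e c) n nP)).
Qed.

Let pf (t : TM) (s : TN) x := p (den x) (t x) (s (w ^- den x)).

Let pfE t s n x c : w ^+ n * x = e c -> pf t s x = p n (t x) (s (w ^- n)).
Proof.
move=> h; have [c' h'] := denP x.
by rewrite /pf -(level_raise _ _ n h') addnC (level_raise _ _ _ h).
Qed.

Lemma tate_pairing_fun (t : TM) (s : TN) : {f : W |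
  forall n x c, w ^+ n * x = e c -> f x = p n (t x) (s (w ^- n))}.
Proof.
unshelve eexists; first exists (pf t s : Kq -> Fq^o).
- move=> x y; have [n [b [c [b' [c' [h h']]]]]] := unif_repr2 hU x y.
  have hxy : w ^+ n * (x + y) = e (j b + j a ^+ n * c + (j b' + j a ^+ n * c')).
    by rewrite mulrDr h h' -rmorphD.
  rewrite (pfE _ _ h) (pfE _ _ h') (pfE _ _ hxy) quot_homD.
  by rewrite (tp_addr hp') ?(tate_a _ h) ?(tate_a _ h') ?(tate_a _ (hint _)).
- move=> c; have h0 : w ^+ 0 * e c = e c by rewrite expr0 mul1r.
  rewrite (pfE _ _ h0) quot_hom_int.
  have ya := tate_a s (hint 0).
  by have := tp_scale hp 0 (scaler0 _ _) ya; rewrite scaler0 mul0r.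
- move=> l x; have [c h] := denP x.
  have hl : w ^+ den x * (e (j l%:A) * x) = e (j l%:A * c).
    by rewrite mulrCA h rmorphM.
  rewrite (pfE _ _ hl) (pfE _ _ h) quot_homZ (tp_scale hp) //.
    exact: tate_a h.
  exact: tate_a (hint _).
exact: pfE.
Qed.

Let B (t : TM) (s : TN) : W := sval (tate_pairing_fun t s).
Let BE (t : TM) (s : TN) n x c :
  w ^+ n * x = e c -> B t s x = p n (t x) (s (w ^- n)).
Proof. exact: (svalP (tate_pairing_fun t s)). Qed.

Let nondeg n (x : M) : tors j a n x ->
  (forall y : N, tors j a n y -> p n x y = 0) -> x = 0.
Proof. exact: (tors_nondeg hU hp' finN). Qed.

Let nondeg' n (y : N) : tors j a n y ->
  (forall x : M, tors j a n x -> p n x y = 0) -> y = 0.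
Proof. exact: (tors_nondeg hU hp finM). Qed.

Let B' (s : TN) (t : TM) := B t s.
Let BE' (s : TN) (t : TM) n x c :
  w ^+ n * x = e c -> B' s t x = p n (t (w ^- n)) (s x).
Proof. exact: (pairing_sym hU hp BE). Qed.

Let B_bilinear : bilinear_for *:%R *:%R B.
Proof.
split=> [s c t t'|t c s s']; apply: quot_hom_ext => x; have [d h] := denP x.
  have hc : w ^+ den x * (e c * x) = e (c * d) by rewrite mulrCA h rmorphM.
  rewrite /= (BE _ _ h) (BE _ _ h) (BE _ _ hc) /=.
  by rewrite (tp_addr hp') ?(tate_a _ h) ?(tate_a _ hc) ?(tate_a _ (hint _)).
have hc : w ^+ den x * (e c * x) = e (c * d) by rewrite mulrCA h rmorphM.
have := BE' (c *: s + s') t h; have := BE' s' t h; have := BE' s t hc.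
rewrite /B' /= => -> -> ->.
by rewrite (tp_addr hp) ?(tate_a _ h) ?(tate_a _ hc) ?(tate_a _ (hint _)).
Qed.

HB.instance Definition _ := @bilinear_isBilinear.Build Aq TM TN W
  *:%R *:%R B B_bilinear.

Lemma tate_pairing : exists B : {bilinear TM -> TN -> W},
  [/\ forall t s n x c, w ^+ n * x = e c -> B t s x = p n (t x) (s (w ^- n)),
      continuous (fun ts : TM * TN => (B ts.1 ts.2 : W)) & perfect_pairing B].
Proof.
exists B; split; first exact: BE.
- case=> t s; apply: quot_hom_continuous_at => x; have [c h] := denP x.
  exists ([set t' : TM | t' x = t x],
          [set s' : TN | s' (w ^- den x) = s (w ^- den x)]).
    by split; apply: quot_hom_eval_nbhs.
  by case=> t' s' /= [E1 E2]; rewrite !(BE _ _ h) E1 E2.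
split=> g.
  have [t tP] := pairing_repr hU hp hp' finM finN divN nondeg BE g.
  exists t; split=> // t' t'P.
  apply: (pairing_inj hU hp' finN BE') => [n y|s]; last by rewrite /B' tP t'P.
  exact: (tate_surj hU finN divN).
have [s sP] := pairing_repr hU hp' hp finN finM divM nondeg' BE' g.
exists s; split=> // s' s'P.
apply: (pairing_inj hU hp finM BE) => [n y|t]; last by rewrite s'P; apply: sP.
exact: (tate_surj hU finM divM).
Qed.

End TatePairing.

(** * The dual of Kq/Aq *)

Section SeparatingFunctional.
Variables (F K : fieldType) (k : {rmorphism F -> K}).

Let subsp (U : set K) := U 0 /\ forall c x y, U x -> U y -> U (k c * x + y).

(** Zorn gives a subspace U containing S and maximal among those that miss x0. Then K is the sum of
    U and the line of x0, and chi is the coordinate along x0. *)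
Lemma separating_functional (S : set K) (x0 : K) :
  S 0 -> (forall c x y, S x -> S y -> S (k c * x + y)) -> ~ S x0 ->
  exists chi : K -> F, [/\ forall c x y, chi (k c * x + y) = c * chi x + chi y,
    forall x, S x -> chi x = 0 & chi x0 = 1].
Proof.
(* Taking the union with S makes the condition hold for the union of the empty chain too. *)
move=> S0 SP Sx0; pose P X := subsp (S `|` X) /\ ~ (S `|` X) x0.
have [|X [[[U0 UP] Ux0] Xmax]] := @Zorn_bigcup K P.
  move=> G GP Gtot; split; last first.
    by move=> [//|[X GX Xx0]]; case: (GP X GX) => _; apply; right.
  split=> [|c x y]; first by left.
  have inG X z : G X -> X z -> (S `|` \bigcup_(Y in G) Y) z by move=> *; right; exists X.
  have step X x' y' : G X -> (S `|` X) x' -> (S `|` X) y' ->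
      (S `|` \bigcup_(Y in G) Y) (k c * x' + y').
    move=> GX hx hy; have [[_ XP] _] := GP X GX.
    by case: (XP c _ _ hx hy) => [|/(inG _ _ GX)//]; left.
  move=> [Sx|[X GX Xx]] [Sy|[Y GY Yy]].
  - by left; apply: SP.
  - by apply: (step Y) => //; [left|right].
  - by apply: (step X) => //; [right|left].
  have [XY|YX] := Gtot X Y GX GY.
    by apply: (step Y) => //; right => //; apply: XY.
  by apply: (step X) => //; right => //; apply: YX.
set U := S `|` X in U0 UP Ux0.
have UD x y : U x -> U y -> U (x + y).
  by move=> hx hy; have := UP 1 x y hx hy; rewrite rmorph1 mul1r.
have UZ c x : U x -> U (k c * x).
  by move=> hx; have := UP c x 0 hx U0; rewrite addr0.
have UN x : U x -> U (- x) by move=> /(UZ (-1)); rewrite rmorphN1 mulN1r.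
have ex y : exists c, U (y - k c * x0).
  have [Uy|Uy] := pselect (U y); first by exists 0; rewrite rmorph0 mul0r subr0.
  (* The span of U and y; by maximality of U it contains x0. *)
  pose U' : set K := [set z | exists c u, U u /\ z = k c * y + u].
  have UU' z : U z -> U' z by exists 0, z; rewrite rmorph0 mul0r add0r.
  have SU' : S `|` U' = U'.
    by apply/seteqP; split=> z; [case=> // Sz; apply: UU'; left|right].
  have [[c [u [Uu x0E]]]|nx0] := pselect (U' x0); last first.
    exfalso; apply: (Xmax U'); last first.
      split; rewrite SU' //; split=> [|c x z]; first exact: UU'.
      move=> [d [u [Uu ->]]] [d' [u' [Uu' ->]]].
      exists (c * d + d'), (k c * u + u'); split; first exact: UP.
      by rewrite rmorphD rmorphM; ring.
    split; first by move=> z Xz; apply: UU'; right.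
    move=> /(_ y) H; apply: Uy; right; apply: H.
    by exists 1, 0; rewrite rmorph1 mul1r addr0.
  have c0 : c != 0.
    by apply/eqP => c0; apply: Ux0; rewrite x0E c0 rmorph0 mul0r add0r.
  exists c^-1; rewrite x0E mulrDr mulrA -rmorphM mulVf // rmorph1 mul1r opprD.
  by rewrite addrA subrr add0r; apply/UN/UZ.
have uniq_c y c c' : U (y - k c * x0) -> U (y - k c' * x0) -> c = c'.
  move=> h h'; apply/eqP; rewrite -subr_eq0; apply/negPn/negP => cc; apply: Ux0.
  have := UD _ _ h' (UN _ h); move/(UZ (c - c')^-1).
  suff -> : k (c - c')^-1 * (y - k c' * x0 - (y - k c * x0)) = x0 by [].
  rewrite fmorphV rmorphB.
  have -> : y - k c' * x0 - (y - k c * x0) = (k c - k c') * x0 by ring.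
  by rewrite mulrA mulVf ?mul1r // -rmorphB fmorph_eq0.
have [chi chiP] := choice ex.
exists chi; split=> [c x y|x Sx|].
- apply: (uniq_c _ _ _ (chiP _)); rewrite rmorphD rmorphM.
  have -> : k c * x + y - (k c * k (chi x) + k (chi y)) * x0 =
    k c * (x - k (chi x) * x0) + (y - k (chi y) * x0) by ring.
  exact: UP.
- by apply: (uniq_c _ _ _ (chiP _)); rewrite rmorph0 mul0r subr0; left.
- by apply: (uniq_c _ _ _ (chiP _)); rewrite rmorph1 mul1r subrr.
Qed.

End SeparatingFunctional.

Section ResidueDual.
Variables (Fq : finFieldType) (A : comAlgType Fq) (Aq : comNzRingType).
Variables (Kq : fieldType) (j : {rmorphism A -> Aq}) (e : {rmorphism Aq -> Kq}).
Variable a : A.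
Hypothesis hU : uniformizer j e a.
Local Notation w := (e (j a)).
Local Notation W := (residue_dual Fq A j e).
Let w0 := unif_neq0 hU.

Hypothesis a_nonunit : forall c, e c != w^-1.
Hypothesis unit_or_div : forall c, (exists c', c = j a * c') \/ (exists c', c * c' = 1).
Hypothesis residue_fin : exists s : seq A, forall c, exists (l : A -> Fq) c',
  c = \sum_(d <- s) j ((l d)%:A * d) + j a * c'.
Hypothesis series : forall u : nat -> Aq, exists c, forall n, exists c',
  c = \sum_(i < n) u i * j a ^+ i + j a ^+ n * c'.

Let kk : {rmorphism Fq -> Kq} := e \o (j \o GRing.in_alg A).

Lemma residue_generator : exists chi : W, chi w^-1 = 1.
Proof.
have [| | |f [fP f0 f1]] := @separating_functional Fq Kq kk (range e) w^-1.
- by exists 0; rewrite ?rmorph0.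
- move=> c _ _ [x _ <-] [y _ <-]; exists (j c%:A * x + y) => //.
  by rewrite rmorphD rmorphM.
- by case=> c _ h; have := a_nonunit c; rewrite h eqxx.
unshelve eexists; first exists (f : Kq -> Fq^o).
- by move=> x y; have := fP 1 x y; rewrite rmorph1 !mul1r.
- by move=> c; apply: f0; exists c.
- by move=> c x; have := fP c x 0; rewrite (f0 0) ?addr0 //; exists 0; rewrite ?rmorph0.
exact: f1.
Qed.

Let W0 (f : W) : f 0 = 0. Proof. by rewrite -(rmorph0 e) quot_hom_int. Qed.
Let Wsum (f : W) (I : Type) (s : seq I) (E : I -> Kq) :
  f (\sum_(i <- s) E i) = \sum_(i <- s) f (E i).
Proof. exact: (big_morph f (quot_homD f) (W0 f)). Qed.
Let WZ (f : W) l x : f (e (j l%:A) * x) = l * f x.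
Proof. exact: (quot_homZ f). Qed.
Let W_div (f : W) x : f (w^-1 * e (j a * x)) = 0.
Proof. by rewrite rmorphM mulrA mulVf // mul1r quot_hom_int. Qed.

(** On a^-1 Aq / Aq, a copy of the residue field, the functionals d chi with d in [s] have only 0 as
    common zero: a unit there would give chi(a^-1) = 0. So f agrees with some c0 chi on a^-1 Aq, and
    a functional that vanishes on a^-1 Aq is divisible by a. *)
Lemma residue_dual_step (chi f : W) : chi w^-1 = 1 ->
  exists c (f' : W), f = c *: chi + j a *: f'.
Proof.
move=> chi1; have [s sP] := residue_fin.
pose comb (l : Fq) (y z : Aq) := j l%:A * y + z.
have lin (g : W) d : linear_on comb (fun=> True) (fun c => g (w^-1 * e (d * c))).
  move=> l y z _ _.
  have := quot_homD g (e (j l%:A) * (w^-1 * e (d * y))) (w^-1 * e (d * z)).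
  rewrite WZ => <-; congr (g _).
  by rewrite /comb !(rmorphM, rmorphD) /=; ring.
have [//| | |x _ hx|l lP] := @functional_span Fq Aq comb (fun=> True) A s
    (fun d c => chi (w^-1 * e (j d * c))) (fun c => f (w^-1 * e c)).
- by move=> d _; apply: lin.
- by move=> l y z ? ?; have := lin f 1 l y z; rewrite !mul1r; apply.
- have [[c' ->]|[c' cc']] := unit_or_div x; first exact: W_div.
  have [l [c'' c'E]] := sP c'; exfalso; have /eqP := chi1; apply/negP.
  have -> : chi w^-1 = chi (w^-1 * e (c' * x)) by rewrite [c' * x]mulrC cc' rmorph1 mulr1.
  rewrite c'E mulrDl -mulrA rmorphD mulrDr quot_homD W_div addr0.
  rewrite mulr_suml rmorph_sum mulr_sumr Wsum big_seq big1 ?[0 == _]eq_sym ?oner_eq0 //.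
  by move=> d ds; rewrite (rmorphM j) -mulrA (rmorphM e) mulrCA WZ hx // mulr0.
pose c0 := \sum_(d <- undup s) j ((l d)%:A * d).
have c0P c : f (w^-1 * e c) = chi (e c0 * (w^-1 * e c)).
  rewrite lP // rmorph_sum mulr_suml Wsum; apply: eq_bigr => d _.
  by rewrite -WZ; congr (chi _); rewrite !rmorphM; ring.
exists c0; unshelve eexists.
  exists (fun x => (f - c0 *: chi) (w^-1 * x)).
  - by move=> x y; rewrite mulrDr quot_homD.
  - by move=> c; rewrite /= c0P subrr.
  - by move=> b x; rewrite mulrCA quot_homZ.
apply: quot_hom_ext => x /=; rewrite mulrA mulVf // mul1r.
by rewrite addrC subrK.
Qed.

(** Injectivity: for c nonzero, c chi takes the value chi(a^-1) = 1 at 1 / (c a). Surjectivity: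
    iterating [residue_dual_step] gives digits u_n; at x with a^n x integral, everything beyond the
    n-th digit evaluates to 0. *)
Lemma residue_dual_free : exists f : {linear Aq^o -> W}, bijective f.
Proof.
have [chi chi1] := residue_generator.
pose F (c : Aq^o) : W := (c : Aq) *: chi.
have Flin : linear F by move=> c x y; rewrite /F scalerDl scalerA.
pose Fl : {linear Aq^o -> W} := HB.pack F (GRing.isLinear.Build Aq Aq^o W _ F Flin).
have Finj (c d : Aq) : c *: chi = d *: chi -> c = d.
  move=> cd; apply/eqP; rewrite -subr_eq0; apply/negPn/negP => cd0.
  have ecd : e (c - d) != 0.
    by apply: contra cd0 => /eqP; rewrite -[0](rmorph0 e) => /(unif_inj hU) ->.
  have : ((c - d) *: chi) ((e (c - d))^-1 / w) = 0.
    by rewrite scalerBl cd subrr.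
  by rewrite /= mulrA divff // mul1r chi1 => /eqP; rewrite oner_eq0.
have Fsurj f : exists c, F c = f.
  have step (g : W) : {cg : Aq * W | g = cg.1 *: chi + j a *: cg.2}.
    by apply: cid; have [c [g' gE]] := residue_dual_step g chi1; exists (c, g').
  pose fn n := iter n (fun g => (sval (step g)).2) f.
  pose u n := (sval (step (fn n))).1.
  have fS n : fn n = u n *: chi + j a *: fn n.+1 by apply: (svalP (step (fn n))).
  have fE n : f = (\sum_(i < n) u i * j a ^+ i) *: chi + j a ^+ n *: fn n.
    elim: n => [|n IH]; first by rewrite big_ord0 scale0r add0r expr0 scale1r.
    rewrite {1}IH fS big_ord_recr scalerDl -addrA scalerDr !scalerA -exprSr.
    by rewrite [j a ^+ n * u n]mulrC.
  have [c cP] := series u; exists c; apply: quot_hom_ext => x.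
  have [n [d h]] := unif_denom hU x; have [c' cE] := cP n.
  rewrite (fE n) /F cE scalerDl /=; congr (_ + _).
  rewrite rmorphM rmorphXn mulrAC h -rmorphM.
  by rewrite (quot_hom_int chi) (quot_hom_int (fn n)).
exists Fl; apply: (@Bijective _ _ _ (fun y => xget 0 [set c | F c = y])).
  by move=> c; apply: Finj; apply: (xgetPex 0 (Fsurj (F c))).
by move=> f; apply: (xgetPex 0 (Fsurj f)).
Qed.

End ResidueDual.

(** * Finiteness of the residue field *)

Section ResidueFinite.
Variables (Fq : finFieldType) (K : fieldType) (k : {rmorphism Fq -> K}).

(** Counting replaces rank: the coefficient map from Fq^X to Fq^Y cannot be injective, and the
    difference of two vectors with the same image is a relation. *)
Lemma dependent_of_span (X Y : finType) (x : X -> K) (y : Y -> K)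
    (C : X -> Y -> Fq) : (#|Y| < #|X|)%N ->
  (forall i, x i = \sum_(l : Y) k (C i l) * y l) ->
  exists2 lam : X -> Fq, (exists i, lam i != 0) & \sum_i k (lam i) * x i = 0.
Proof.
move=> cardXY xE.
pose f (lam : {ffun X -> Fq}) : {ffun Y -> Fq} := [ffun l => \sum_i lam i * C i l].
have ninj : ~ injective f.
  move=> /leq_card; rewrite !card_ffun; apply/negP; rewrite -ltnNge ltn_exp2l //.
  exact: finNzRing_gt1.
have [[lam [mu [lm nlm]]]|H] :=
    pselect (exists lam mu, f lam = f mu /\ lam != mu); last first.
  case: ninj => lam mu lm; apply/eqP/negPn/negP => nlm; apply: H.
  by exists lam, mu.
exists (fun i => lam i - mu i).
  apply: contrapT => H; case/eqP: nlm; apply/ffunP => i; apply/eqP.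
  by rewrite -subr_eq0; apply/negPn/negP => hi; apply: H; exists i.
under eq_bigr do rewrite xE mulr_sumr.
rewrite exchange_big big1 //= => l _.
under eq_bigr do rewrite mulrA -rmorphM.
rewrite -mulr_suml -rmorph_sum.
have := congr1 (fun g : {ffun Y -> Fq} => g l) lm; rewrite !ffunE => E.
under eq_bigr do rewrite mulrBl.
by rewrite sumrB E subrr rmorph0 mul0r.
Qed.

Section BoundedDegree.
Variables (t : K) (N : nat) (b : 'I_N -> K).
Hypothesis t_trans : ~ algebraicOver k t.
Hypothesis b_span : forall f : K, exists (g : {poly Fq}) (c : 'I_N -> {poly Fq}),
  g != 0 /\ (map_poly k g).[t] * f = \sum_(i < N) (map_poly k (c i)).[t] * b i.

Local Notation ev p := (map_poly k p).[t].

Let evM p q : ev (p * q) = ev p * ev q.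
Proof. by rewrite rmorphM hornerM. Qed.

Let ev_neq0 p : p != 0 -> ev p != 0.
Proof. by move=> p0; apply/negP => h; apply: t_trans; exists p. Qed.

(* the Fq-span of the t^r b_l with r < n *)
Definition bounded_span n x := exists2 c : 'I_N -> {poly Fq},
  forall l, (size (c l) <= n)%N & x = \sum_l ev (c l) * b l.
Local Notation V := bounded_span.

Lemma bounded_span0 n : V n 0.
Proof.
exists (fun=> 0) => [l|]; first by rewrite size_poly0.
by rewrite big1 // => l _; rewrite rmorph0 horner0 mul0r.
Qed.

Lemma bounded_spanD n x y : V n x -> V n y -> V n (x + y).
Proof.
move=> [c sc ->] [d sd ->]; exists (fun l => c l + d l) => [l|].
  by apply: leq_trans (size_polyD _ _) _; rewrite geq_max sc sd.
rewrite -big_split; apply: eq_bigr => l _ /=.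
by rewrite rmorphD hornerD mulrDl.
Qed.

Lemma bounded_spanW n m x : (n <= m)%N -> V n x -> V m x.
Proof. by move=> nm [c sc ->]; exists c => // l; apply: leq_trans nm. Qed.

Lemma bounded_spanM n m (p : {poly Fq}) x :
  (size p <= m.+1)%N -> V n x -> V (n + m) (ev p * x).
Proof.
move=> sp [c sc ->]; exists (fun l => p * c l) => [l|].
  have [-> |p0] := eqVneq p 0; first by rewrite mul0r size_poly0.
  have [-> |c0] := eqVneq (c l) 0; first by rewrite mulr0 size_poly0.
  rewrite size_mul //; have := sc l; have := size_poly_gt0 p; rewrite p0.
  by case: (size p) sp => // r; rewrite ltnS addSn /= addnC => rm _ sc'; apply: leq_add.
by rewrite mulr_sumr; apply: eq_bigr => l _; rewrite evM mulrA.
Qed.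

Lemma common_denominator (s : seq K) : exists g n, g != 0 /\
  forall x, x \in s -> V n (ev g * x).
Proof.
elim: s => [|x s [g [n [g0 gP]]]]; first by exists 1, 0%N; rewrite oner_neq0.
have [h [c [h0 hP]]] := b_span x.
have Vx : V (\max_l size (c l)) (ev h * x).
  by exists c => // l; apply: leq_bigmax.
exists (g * h), (n + size h + (\max_l size (c l) + size g))%N.
split=> [|y]; first by rewrite mulf_neq0.
rewrite inE evM => /predU1P[->|/gP Vy].
  rewrite -mulrA; apply: bounded_spanW (leq_addl _ _) _.
  exact: bounded_spanM (leqnSn _) Vx.
rewrite [ev g * _]mulrC -mulrA; apply: bounded_spanW (leq_addr _ _) _.
exact: bounded_spanM (leqnSn _) Vy.
Qed.

(* After clearing denominators, the elements a^i u_l with i < n lie in a space *)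
(* of dimension N (C + E n), with E independent of u.                          *)
Lemma growth_bound (a : K) : exists m, forall u : 'I_m -> K,
  exists n, exists2 lam : 'I_n * 'I_m -> Fq, (exists i, lam i != 0) &
    \sum_i k (lam i) * (a ^+ i.1 * u i.2) = 0.
Proof.
have [D [E0 [D0 DP]]] := common_denominator [seq a * b l | l : 'I_N].
pose E := (E0 + size D)%N.
have VDa n x : V n x -> V (n + E) (ev D * (a * x)).
  move=> [c sc ->]; rewrite !mulr_sumr.
  elim/big_ind: _ => [|y z|l _]; [exact: bounded_span0|exact: bounded_spanD|].
  have -> : ev D * (a * (ev (c l) * b l)) = ev (c l) * (ev D * (a * b l)) by ring.
  rewrite addnC; apply: bounded_spanM; first exact: leq_trans (sc l) _.
  by apply: bounded_spanW (leq_addr _ _) (DP _ _); apply: map_f; rewrite mem_enum.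
have VD n x : V n x -> V (n + E) (ev D * x).
  by apply: bounded_spanM; rewrite /E ltnW // ltnS leq_addl.
(* Raising n by one adds N E + 1 products a^i u_l but only N E dimensions; n = N C + 1 then
   outweighs the constant term N C. *)
exists (N * E).+1 => u.
have [G [C [G0 GP]]] := common_denominator [seq u l | l : 'I_(N * E).+1].
pose n := (N * C).+1; exists n.
have VDn r i x m : V m x -> V (m + E * (r + i)) (ev D ^+ r * (ev D ^+ i * (a ^+ i * x))).
  move=> Vx; elim: r => [|r IH]; last first.
    rewrite exprS -mulrA addSn mulnS addnCA addnC; exact: VD.
  rewrite expr0 mul1r add0n; elim: i => [|i IH].
    by rewrite !expr0 !mul1r muln0 addn0.
  have -> : ev D ^+ i.+1 * (a ^+ i.+1 * x) =
    ev D * (a * (ev D ^+ i * (a ^+ i * x))) by rewrite !exprS; ring.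
  by rewrite mulnS addnCA addnC; apply: VDa.
have Vx (il : 'I_n * 'I_(N * E).+1) :
    V (C + E * n) (ev D ^+ n * (ev G * (a ^+ il.1 * u il.2))).
  case: il => i l /=; have il : (i <= n)%N by apply: ltnW.
  have Gu : V C (ev G * u l) by apply: GP; apply: map_f; rewrite mem_enum.
  have Dn : ev D ^+ n = ev D ^+ (n - i) * ev D ^+ i by rewrite -exprD subnK.
  have := VDn (n - i)%N i _ _ Gu; rewrite subnK //; congr (V _ _).
  by rewrite Dn; ring.
have Vx' (il : 'I_n * 'I_(N * E).+1) : exists c : 'I_N -> {poly Fq},
    (forall l, (size (c l) <= C + E * n)%N) /\
    ev D ^+ n * (ev G * (a ^+ il.1 * u il.2)) = \sum_l ev (c l) * b l.
  by have [c] := Vx il; exists c.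
have [c cP] := choice Vx'.
have [||lam lam0 lamP] := @dependent_of_span ('I_n * 'I_(N * E).+1)%type
    ('I_N * 'I_(C + E * n))%type
    (fun il => ev D ^+ n * (ev G * (a ^+ il.1 * u il.2)))
    (fun lr => t ^+ lr.2 * b lr.1) (fun il lr => (c il lr.1)`_lr.2).
- rewrite !card_prod !card_ord mulnDr mulnA [(n * _)%N]mulnS.
  by rewrite -[(n * _)%N]mulnC ltn_add2r.
- move=> il; have [sc ->] := cP il.
  rewrite -(pair_bigA _ (fun (l : 'I_N) (r : 'I_(C + E * n)) =>
    k (c il l)`_r * (t ^+ r * b l))) /=.
  apply: eq_bigr => l _; rewrite (@horner_coef_wide _ (C + E * n)); last first.
    by rewrite size_map_poly.
  by rewrite mulr_suml; apply: eq_bigr => r _; rewrite coef_map mulrA.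
exists lam => //.
have DG0 : ev D ^+ n * ev G != 0.
  by rewrite mulf_neq0 ?expf_neq0 ?ev_neq0.
apply: (mulfI DG0); rewrite mulr0 -[RHS]lamP mulr_sumr; apply: eq_bigr => il _.
by ring.
Qed.
End BoundedDegree.
End ResidueFinite.

Lemma function_field_growth (Fq : finFieldType) (K : fieldType)
    (k : {rmorphism Fq -> K}) (a : K) : function_field k ->
  exists m, forall u : 'I_m -> K,
  exists n, exists2 lam : 'I_n * 'I_m -> Fq, (exists i, lam i != 0) &
    \sum_i k (lam i) * (a ^+ i.1 * u i.2) = 0.
Proof. by move=> [t tt [N [b bP]]]; apply: growth_bound tt bP a. Qed.

Section SpanModulo.
Variables (F : fieldType) (V : lmodType F) (P : V -> Prop) (m : nat).
Hypothesis P0 : P 0.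
Hypothesis PZ : forall c x, P x -> P (c *: x).

Hypothesis dep : forall u : 'I_m -> V,
  exists2 l : 'I_m -> F, (exists i, l i != 0) & P (\sum_i l i *: u i).

(** If no finite list spanned, one could adjoin elements outside the span until m of them are
    independent modulo P, against [dep]. *)
Lemma span_modulo : exists s : seq V, forall x, exists l : V -> F,
  P (x - \sum_(d <- s) l d *: d).
Proof.
apply: contrapT => nospan.
have indep n : exists s : seq V, [/\ uniq s, size s = n & forall l : V -> F,
    P (\sum_(d <- s) l d *: d) -> forall d, d \in s -> l d = 0].
  elim: n => [|n [s [us ss sP]]]; first by exists [::].
  have [x xP] : exists x, forall l : V -> F, ~ P (x - \sum_(d <- s) l d *: d).
    apply: contrapT => H; apply: nospan; exists s => x.
    by apply: contrapT => H'; apply: H; exists x => l Pl; apply: H'; exists l.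
  have xs : x \notin s.
    apply/negP => xs; apply: (xP (fun d => (d == x)%:R)).
    rewrite (bigD1_seq x) //= eqxx scale1r big1 ?addr0 ?subrr // => d dx.
    by rewrite (negbTE dx) scale0r.
  exists (x :: s); split; [by rewrite /= xs|by rewrite /= ss|].
  move=> l; rewrite big_cons => Pl.
  have lx : l x = 0.
    apply: contrapT => /eqP lx; apply: (xP (fun d => - (l x)^-1 * l d)).
    have := PZ (l x)^-1 Pl; rewrite scalerDr scalerA mulVf // scale1r.
    congr (P (_ + _)); rewrite scaler_sumr -sumrN; apply: eq_bigr => d _.
    by rewrite mulNr scaleNr opprK scalerA.
  rewrite lx scale0r add0r in Pl.
  by move=> d; rewrite inE => /predU1P[->//|]; apply: sP.
have [s [us ss sP]] := indep m.
have [l [i li]] := dep (fun i => nth 0 s i).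
have idx : forall d, exists r : F, forall i : 'I_m, d = nth 0 s i -> r = l i.
  move=> d; have [[i0 ->]|H] := pselect (exists i0 : 'I_m, d = nth 0 s i0).
    exists (l i0) => i1 /eqP; rewrite nth_uniq ?ss // => /eqP i01.
    by congr l; apply: val_inj.
  by exists 0 => i1 di1; case: H; exists i1.
have [l' l'P] := choice idx.
have -> : \sum_i l i *: nth 0 s i = \sum_(d <- s) l' d *: d.
  rewrite (big_nth 0) ss big_mkord; apply: eq_bigr => i0 _.
  by rewrite (l'P _ i0).
move=> /sP /(_ (nth 0 s i)); rewrite mem_nth ?ss // => /(_ isT).
by rewrite (l'P _ i) // => li0; rewrite li0 eqxx in li.
Qed.

End SpanModulo.

(** * Green's identity and the finite pairings *)

Section AdditivePolynomials.
Variables (Fq : finFieldType) (L : closedFieldType) (k : {rmorphism Fq -> L}).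
Local Notation q := #|Fq|.

Let q_gt1 : (1 < q)%N. Proof. exact: finNzRing_gt1. Qed.
Let qn_gt0 n : (0 < q ^ n)%N. Proof. by rewrite expn_gt0 ltnW. Qed.

Lemma natr_card0 : (q%:R : L) = 0.
Proof.
have [p p_pr cFp] := finPcharP Fq.
have qE := card_pprimeChar cFp; rewrite /= in qE.
rewrite -(rmorph_nat k) qE natrX (pcharf0 cFp).
case: (logn p _) qE => [|n _]; last by rewrite expr0n rmorph0.
by rewrite expn0 => q1; have := q_gt1; rewrite q1.
Qed.

Definition addpoly d (c : nat -> L) : {poly L} := \sum_(i < d.+1) c i *: 'X^(q ^ i).

Variables (d : nat) (c : nat -> L).
Hypotheses (c0 : c 0%N != 0) (cd : c d != 0).
Local Notation G := (addpoly d c).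

Lemma horner_addpoly z : G.[z] = \sum_(i < d.+1) c i * z ^+ (q ^ i).
Proof. by rewrite horner_sum; apply: eq_bigr => i _; rewrite hornerZ hornerXn. Qed.

Lemma size_addpoly : size G = (q ^ d).+1.
Proof.
rewrite /addpoly big_ord_recr /= addrC size_polyDl ?size_scale ?size_polyXn //.
apply: leq_ltn_trans (size_sum _ _ _) _; rewrite ltnS; apply/bigmax_leqP => i _.
by apply: leq_trans (size_scale_leq _ _) _; rewrite size_polyXn ltn_exp2l.
Qed.

Lemma addpoly_surj w : exists z, G.[z] = w.
Proof.
have : size (G - w%:P) != 1%N.
  rewrite size_polyDl ?size_addpoly; first by rewrite eqSS -lt0n.
  by rewrite size_polyN (leq_ltn_trans (size_polyC_leq1 _)) // ltnS.
case/closed_rootP => z; rewrite rootE hornerD hornerN hornerC subr_eq0 => /eqP.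
by exists z.
Qed.

(** The derivative is the nonzero constant [c 0], since q = 0 in L; so the polynomial is
    separable. *)
Lemma addpoly_roots : exists s : seq L, [/\ uniq s, size s = (q ^ d)%N &
  forall z, (z \in s) = (G.[z] == 0)].
Proof.
have [s [l l0 sE]] : exists s, exists2 l, l != 0 &
    G = l *: \prod_(z <- s) ('X - z%:P).
  have [s sE] := closed_field_poly_normal G; exists s, (lead_coef G) => //.
  by rewrite lead_coef_eq0 -size_poly_eq0 size_addpoly.
have rE z : (z \in s) = (G.[z] == 0).
  by rewrite -[RHS]/(root G z) sE rootZ // root_prod_XsubC.
exists s; split=> //; last first.
  apply: succn_inj; rewrite -size_addpoly sE size_scale //.
  by rewrite size_prod_XsubC.
rewrite -separable_prod_XsubC.
have : separable_poly G.
  rewrite unlock.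
  have -> : G^`() = (c 0%N)%:P.
    rewrite /addpoly big_ord_recl derivD derivZ expn0 expr1 derivX alg_polyC.
    rewrite [X in _ + X](_ : _ = 0) ?addr0 //.
    rewrite (linear_sum (@deriv L)) big1 // => i _.
    rewrite linearZ /= derivXn expnS -mulr_natl natrM -[q%:R](rmorph_nat (@polyC L)).
    by rewrite natr_card0 rmorph0 !mul0r scaler0.
  by rewrite -alg_polyC coprimepZr // coprimep1.
by rewrite sE !unlock derivZ coprimepZl // coprimepZr.
Qed.

Lemma addpoly_vanish (H : {poly L}) : (size H <= q ^ d)%N ->
  (forall z, G.[z] = 0 -> H.[z] = 0) -> H = 0.
Proof.
move=> sH Hz; have [s [us ss sE]] := addpoly_roots.
apply: contraTeq sH => H0; rewrite -ltnNge -ss; apply: max_poly_roots => //.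
by apply/allP => z; rewrite sE => /eqP /Hz; rewrite rootE => ->.
Qed.

End AdditivePolynomials.

Section Green.
Variables (Fq : finFieldType) (L : fieldType) (Lbar : closedFieldType).
Variables (k : {rmorphism Fq -> L}) (emb : {rmorphism L -> Lbar}).
Local Notation q := #|Fq|.
Local Notation tw := (twisted k).
Let kbar : {rmorphism Fq -> Lbar} := emb \o k.

(** A partial trace, chosen because Frobenius minus the identity telescopes on it to y^(q^n) - y. *)
Definition qtrace n (y : Lbar) := \sum_(l < n) y ^+ (q ^ l).

Let frobqD (x y : Lbar) : (x + y) ^+ q = x ^+ q + y ^+ q.
Proof. by have := frobD kbar 1 x y; rewrite expn1. Qed.
Let frobq0 : 0 ^+ q = 0 :> Lbar.
Proof. by have := frob0 Fq Lbar 1; rewrite expn1. Qed.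

Lemma qtraceD n x y : qtrace n (x + y) = qtrace n x + qtrace n y.
Proof. by rewrite -big_split; apply: eq_bigr => l _; rewrite (frobD kbar). Qed.

Lemma qtrace_frob n y : qtrace n y ^+ q = qtrace n y - y + y ^+ (q ^ n).
Proof.
elim: n => [|n IH].
  by rewrite /qtrace !big_ord0 frobq0 expn0 expr1 sub0r addNr.
rewrite /qtrace big_ord_recr /= -/(qtrace n y) frobqD IH.
by rewrite -exprM -expnSr; ring.
Qed.

Lemma qtrace_add m n y : qtrace (m + n) y = qtrace n y + qtrace m (y ^+ (q ^ n)).
Proof.
elim: m => [|m IH]; first by rewrite /qtrace big_ord0 addr0.
rewrite addSn /qtrace !big_ord_recr /= -!/(qtrace _ _) IH -addrA -exprM -expnD.
by rewrite [(n + m)%N]addnC.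
Qed.

(* The pairing between ker f and ker f^*: Green's identity below shows that it *)
(* takes values in Fq there.                                                   *)
Definition green (f : tw) (x y : Lbar) : Lbar :=
  \sum_(i < size (f : {poly L})) qtrace i
    (qroot Fq i (emb (f : {poly L})`_i) * qroot Fq i y * x).

Let greenF x y i b := qtrace i (qroot Fq i (emb b) * qroot Fq i y * x).
Let greenFD x y i b c : greenF x y i (b + c) = greenF x y i b + greenF x y i c.
Proof. by rewrite /greenF rmorphD (qrootD k emb) !mulrDl qtraceD. Qed.

Lemma greenDf f g x y : green (f + g) x y = green f x y + green g x y.
Proof. exact: (sum_coefD (greenFD x y)). Qed.
Lemma green0f x y : green 0 x y = 0.
Proof. exact: (sum_coef0 (greenF x y)). Qed.
Lemma greenZX b n x y : green (b *: 'X^n : {poly L}) x y =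
  qtrace n (qroot Fq n (emb b) * qroot Fq n y * x).
Proof. exact: (sum_coefZX (greenFD x y)). Qed.

Lemma greenDl f x x' y : green f (x + x') y = green f x y + green f x' y.
Proof.
by rewrite -big_split; apply: eq_bigr => i _; rewrite mulrDr qtraceD.
Qed.
Lemma greenDr f x y y' : green f x (y + y') = green f x y + green f x y'.
Proof.
rewrite -big_split; apply: eq_bigr => i _.
by rewrite (qrootD k emb) mulrDr mulrDl qtraceD.
Qed.
Lemma green0l f y : green f 0 y = 0.
Proof. by apply: (addIr (green f 0 y)); rewrite -greenDl !add0r. Qed.
Lemma green0r f x : green f x 0 = 0.
Proof. by apply: (addIr (green f x 0)); rewrite -greenDr !add0r. Qed.

Lemma green_scale f (l : Fq) x y : green f (kbar l * x) y = kbar l * green f x y.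
Proof.
rewrite mulr_sumr; apply: eq_bigr => i _; rewrite /qtrace mulr_sumr.
apply: eq_bigr => m _; rewrite mulrCA exprMn; congr (_ * _).
have lq n : l ^+ (q ^ n) = l.
  by elim: n => [|n IH]; rewrite ?expr1 // expnSr exprM IH expf_card.
by rewrite -rmorphXn lq.
Qed.

(** By additivity take f = b tau^n. The argument of the trace is then the adjoint value times x, and
    its q^n-th power is b y x^(q^n). *)
Lemma green_identity f x y :
  green f x y ^+ q - green f x y = y * twisted_act emb f x - adjoint_act emb f y * x.
Proof.
elim/poly_add_ind: f => [|f g IHf IHg|b n].
- rewrite green0f twisted_act0 adjoint_act0 mulr0 mul0r !subr0.
  by rewrite frobq0.
- rewrite greenDf twisted_actDl (adjoint_actDl emb) frobqD.
  by rewrite opprD addrACA IHf IHg; ring.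
rewrite greenZX twisted_actZX adjoint_actZX qtrace_frob !exprMn !qrootK; ring.
Qed.

(** On monomials of degrees n and m, a trace of length n + m splits: its first m terms belong to g
    and its last n terms to f. *)
Lemma greenM f g x y : green (f * g) x y =
  green f (twisted_act emb g x) y + green g x (adjoint_act emb f y).
Proof.
elim/poly_add_ind: f => [|f f' IHf IHf'|b n].
- by rewrite mul0r !green0f adjoint_act0 green0r addr0.
- by rewrite mulrDl !greenDf IHf IHf' adjoint_actDl greenDr addrACA.
elim/poly_add_ind: g => [|g g' IHg IHg'|b' m].
- by rewrite mulr0 !green0f twisted_act0 green0l addr0.
- by rewrite mulrDr !greenDf IHg IHg' twisted_actDl greenDl addrACA.
rewrite [_ * _](twisted_mulX k) !greenZX qtrace_add addrC twisted_actZX adjoint_actZX.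
rewrite rmorphM rmorphXn !(qrootM k emb) !(qroot_qroot k emb) (qrootX k emb).
congr (qtrace _ _ + qtrace _ _); last by ring.
by rewrite !exprMn -!(qroot_qroot k emb) !qrootK; ring.
Qed.

End Green.

Section FrobeniusSums.
Variables (Fq : finFieldType) (L : fieldType).
Local Notation q := #|Fq|.
Let q_gt1 : (1 < q)%N. Proof. exact: finNzRing_gt1. Qed.
Let qexp_eq m n : (q ^ m == q ^ n)%N = (m == n).
Proof. by rewrite eqn_exp2l. Qed.

Lemma size_qsum d (s : nat -> nat -> L) (x : nat -> nat -> nat) :
  (forall i l, (i <= d)%N -> (l < i)%N -> (x i l < d)%N) ->
  (size (\sum_(i < d.+1) \sum_(l < i) s i l *: 'X^(q ^ x i l) : {poly L})%R
    <= q ^ d)%N.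
Proof.
move=> xd; apply: leq_trans (size_sum _ _ _) _; apply/bigmax_leqP => i _.
apply: leq_trans (size_sum _ _ _) _; apply/bigmax_leqP => l _.
apply: leq_trans (size_scale_leq _ _) _; rewrite size_polyXn ltn_exp2l //.
by apply: xd => //; rewrite -ltnS.
Qed.

Lemma coef_qsum_top d (r : nat -> L) : (0 < d)%N ->
  (\sum_(i < d.+1) \sum_(l < i) r i ^+ (q ^ l) *: 'X^(q ^ l) : {poly L})`_(q ^ d.-1) =
  r d ^+ (q ^ d.-1).
Proof.
case: d => // d _ /=; rewrite big_ord_recr /= coefD coef_sum big1 => [|i _].
  rewrite add0r big_ord_recr /= coefD coef_sum big1 => [|l _].
    by rewrite add0r coefZ coefXn eqxx mulr1.
  by rewrite coefZ coefXn qexp_eq gtn_eqF ?mulr0.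
rewrite coef_sum big1 // => l _.
by rewrite coefZ coefXn qexp_eq gtn_eqF ?mulr0 // (leq_trans (ltn_ord l)) // -ltnS.
Qed.

Lemma coef_qsum_bot d (r : nat -> L) : (0 < d)%N ->
  (\sum_(i < d.+1) \sum_(l < i) r i ^+ (q ^ l) *: 'X^(q ^ (d - i + l))
    : {poly L})`_1 = r d.
Proof.
have x1 n : (1 == q ^ n)%N = (n == 0)%N by rewrite -(expn0 q) qexp_eq eq_sym.
move=> d0; rewrite big_ord_recr /= coefD coef_sum big1 => [|i _]; last first.
  rewrite coef_sum big1 // => l _; rewrite coefZ coefXn x1 addn_eq0 subn_eq0.
  by rewrite leqNgt ltn_ord mulr0.
rewrite add0r subnn coef_sum; case: d d0 => // d _; rewrite big_ord_recl /=.
rewrite coefZ coefXn x1 eqxx mulr1 expn0 expr1 big1 ?addr0 // => l _.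
by rewrite coefZ coefXn x1 mulr0.
Qed.

End FrobeniusSums.

Lemma frob_fixed_image (Fq : finFieldType) (K : fieldType)
    (k : {rmorphism Fq -> K}) (z : K) : z ^+ #|Fq| = z -> exists l, k l = z.
Proof.
move=> zq; have : root (map_poly k ('X^#|Fq| - 'X)) z.
  rewrite rootE rmorphB /= map_polyXn map_polyX hornerD hornerN hornerXn hornerX.
  by rewrite zq subrr.
rewrite (finField_genPoly Fq) rmorph_prod /=.
rewrite (eq_bigr (fun x => 'X - (k x)%:P)); last first.
  by move=> x _; rewrite rmorphB /= map_polyX map_polyC.
rewrite rootE horner_prod => /prodf_eq0 [l _].
by rewrite hornerXsubC subr_eq0 => /eqP ->; exists l.
Qed.

(** * Kernels of an operator and of its adjoint *)

Section Kernels.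
Variables (Fq : finFieldType) (L : fieldType) (Lbar : closedFieldType).
Variables (k : {rmorphism Fq -> L}) (emb : {rmorphism L -> Lbar}).
Local Notation q := #|Fq|.
Local Notation tw := (twisted k).
Let kbar : {rmorphism Fq -> Lbar} := emb \o k.

Variable f : tw.
Hypothesis f0 : (f : {poly L})`_0 != 0.
Let d := (size (f : {poly L})).-1.
Let sizef : size (f : {poly L}) = d.+1.
Proof.
rewrite /d prednK // lt0n size_poly_eq0; apply: contraNneq f0 => ->.
by rewrite coef0.
Qed.
Let fd : (f : {poly L})`_d != 0.
Proof.
by rewrite -[_`_d]/(lead_coef (f : {poly L})) lead_coef_eq0 -size_poly_eq0 sizef.
Qed.

Let c i := emb (f : {poly L})`_i.
Let rho i := qroot Fq i (c i).
Let c' i := rho (d - i)%N.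

Let twE z : twisted_act emb f z = (addpoly Fq d c).[z].
Proof. by rewrite horner_addpoly /twisted_act sizef. Qed.

(** Substituting z^(q^d) absorbs the roots of the variable, and the adjoint becomes an additive
    polynomial with the indices reversed. *)
Let adjE z : adjoint_act emb f (z ^+ (q ^ d)) = (addpoly Fq d c').[z].
Proof.
rewrite horner_addpoly /adjoint_act sizef (reindex_inj rev_ord_inj) /=.
apply: eq_bigr => i _; rewrite subSS /c' /rho; congr (_ * _).
apply: (qroot_eq k emb); rewrite -exprM -expnD; congr (z ^+ (q ^ _)).
by rewrite addnC subnK // -ltnS.
Qed.

Let rho_neq0 i : (f : {poly L})`_i != 0 -> rho i != 0.
Proof.
move=> fi; apply: contraNneq fi => r0; have := qrootK Fq i (c i).
rewrite -/(rho i) r0 (frob0 Fq Lbar) /c => /esym/eqP.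
by rewrite fmorph_eq0.
Qed.

Let c0 : c 0 != 0. Proof. by rewrite fmorph_eq0. Qed.
Let cd : c d != 0. Proof. by rewrite fmorph_eq0. Qed.
Let c'0 : c' 0 != 0. Proof. by rewrite /c' subn0 rho_neq0. Qed.
Let c'd : c' d != 0. Proof. by rewrite /c' subnn rho_neq0. Qed.

Lemma twisted_act_surj w : exists z, twisted_act emb f z = w.
Proof. by have [z zw] := addpoly_surj Fq cd w; exists z; rewrite twE. Qed.

Lemma adjoint_act_surj w : exists z, adjoint_act emb f z = w.
Proof.
by have [z zw] := addpoly_surj Fq c'd w; exists (z ^+ (q ^ d)); rewrite adjE.
Qed.

Lemma twisted_ker_finite :
  exists s : seq Lbar, forall z, twisted_act emb f z = 0 -> z \in s.
Proof.
have [s [_ _ sE]] := addpoly_roots kbar c0 cd; exists s => z.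
by rewrite twE sE => /eqP.
Qed.

Lemma adjoint_ker_finite :
  exists s : seq Lbar, forall z, adjoint_act emb f z = 0 -> z \in s.
Proof.
have [s [_ _ sE]] := addpoly_roots kbar c'0 c'd.
exists [seq z ^+ (q ^ d) | z <- s] => z; rewrite -(qrootK Fq d z) adjE => /eqP.
by rewrite -sE => zs; apply: map_f.
Qed.


(** As a polynomial in x, the form has degree at most q^(d-1) and vanishes on the q^d zeros of f, so
    it is 0; its coefficient at q^(d-1), from i = d and l = d - 1 alone, detects y. *)
Lemma green_nondegr y : adjoint_act emb f y = 0 ->
  (forall x, twisted_act emb f x = 0 -> green emb f x y = 0) -> y = 0.
Proof.
move=> hy Hx.
(* For d = 0 the form is identically 0, but the adjoint is multiplication by a nonzero constant. *)
have [d0|d_gt0] := posnP d.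
  move: hy; rewrite -(qrootK Fq d y) adjE horner_addpoly d0 big_ord1 expn0 !expr1.
  by move/eqP; rewrite mulf_eq0 (negbTE c'0) => /eqP.
pose r i := qroot Fq i (c i) * qroot Fq i y.
pose H : {poly Lbar} :=
  \sum_(i < d.+1) \sum_(l < i) r i ^+ (q ^ l) *: 'X^(q ^ l).
have HE x : H.[x] = green emb f x y.
  rewrite /green sizef horner_sum; apply: eq_bigr => i _.
  rewrite horner_sum; apply: eq_bigr => l _.
  by rewrite hornerZ hornerXn -exprMn.
have H0 : H = 0.
  apply: (addpoly_vanish kbar c0 cd); last by move=> z; rewrite -twE HE; apply: Hx.
  apply: (@size_qsum Fq Lbar d (fun i l => r i ^+ (q ^ l)) (fun _ l => l)).
  by move=> i l id li; apply: leq_trans li _.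
have := coef_qsum_top Fq r d_gt0; rewrite -/H H0 coef0 => /esym/eqP.
rewrite expf_eq0 mulf_eq0 (negbTE (rho_neq0 fd)) => /andP[_ /= /eqP y0].
by rewrite -(qrootK Fq d y) y0 (frob0 Fq Lbar).
Qed.

(** The same argument in y, after substituting y^(q^d) to get a polynomial; here the linear
    coefficient, from i = d and l = 0 alone, is a nonzero multiple of x. *)
Lemma green_nondegl x : twisted_act emb f x = 0 ->
  (forall y, adjoint_act emb f y = 0 -> green emb f x y = 0) -> x = 0.
Proof.
move=> hx Hy.
have [d0|d_gt0] := posnP d.
  move: hx; rewrite twE horner_addpoly d0 big_ord1 expn0 expr1.
  by move/eqP; rewrite mulf_eq0 (negbTE c0) => /eqP.
pose H : {poly Lbar} :=
  \sum_(i < d.+1) \sum_(l < i) (rho i * x) ^+ (q ^ l) *: 'X^(q ^ (d - i + l)).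
have HE y : H.[y] = green emb f x (y ^+ (q ^ d)).
  rewrite /green sizef horner_sum; apply: eq_bigr => i _.
  rewrite horner_sum; apply: eq_bigr => l _.
  have id : (i <= d)%N by rewrite -ltnS.
  have -> : qroot Fq i (y ^+ (q ^ d)) = y ^+ (q ^ (d - i)).
    by apply: (qroot_eq k emb); rewrite -exprM -expnD subnK.
  by rewrite hornerZ hornerXn expnD exprM -exprMn mulrAC.
have H0 : H = 0.
  apply: (addpoly_vanish kbar c'0 c'd); last first.
    by move=> z; rewrite -adjE HE; apply: Hy.
  apply: (@size_qsum Fq Lbar d (fun i l => (rho i * x) ^+ (q ^ l))
    (fun i l => d - i + l)%N) => i l id li.
  by rewrite -[X in (_ < X)%N](subnK id) ltn_add2l.
have := coef_qsum_bot Fq (fun i => rho i * x) d_gt0; rewrite -/H H0 coef0.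
move=> /esym/eqP; rewrite mulf_eq0 (negbTE (rho_neq0 fd)) /= => /eqP.
by [].
Qed.

End Kernels.

(** * The pairing of a Drinfeld module with its adjoint *)

(** Degrees add in L{tau}, because the top coefficient f_m g_n^(q^m) of a product is nonzero. *)
Lemma twisted_unit_const (Fq : finFieldType) (L : fieldType)
    (k : {rmorphism Fq -> L}) (f g : twisted k) :
  f * g = 1 -> (f : {poly L}) = ((f : {poly L})`_0)%:P.
Proof.
move=> fg1; apply: size1_polyC.
have nz (h h' : twisted k) : h * h' = 1 \/ h' * h = 1 -> (h : {poly L}) != 0.
  move=> H; apply/eqP => h0; have {}h0 : h = 0 := h0.
  by case: H => /eqP; rewrite h0 ?mul0r ?mulr0 eq_sym oner_eq0.
have f0 := nz f g (or_introl fg1); have g0 := nz g f (or_intror fg1).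
pose m := (size (f : {poly L})).-1; pose n := (size (g : {poly L})).-1.
have sf : size (f : {poly L}) = m.+1 by rewrite /m prednK // size_poly_gt0.
have sg : size (g : {poly L}) = n.+1 by rewrite /n prednK // size_poly_gt0.
have top : (f * g : {poly L})`_(m + n) != 0.
  rewrite -[f * g]/(twisted_mul Fq f g) /twisted_mul sf sg coef_sum big_ord_recr /=.
  rewrite coef_sum big_ord_recr /= coefZ coefXn eqxx mulr1 !big1 ?add0r.
  - by rewrite mulf_neq0 ?expf_neq0 // lead_coef_eq0.
  - by move=> l _; rewrite coefZ coefXn eqn_add2l gtn_eqF ?mulr0.
  - move=> i _; rewrite coef_sum big1 // => l _; rewrite coefZ coefXn gtn_eqF ?mulr0 //.
    by rewrite -addSn leq_add // -ltnS.
rewrite sf ltnS leqn0; apply: contraR top => m0; rewrite fg1 coef1 addn_eq0.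
by rewrite (negbTE m0).
Qed.

Section DrinfeldPairing.
Variables (Fq : finFieldType) (A : comAlgType Fq) (L : fieldType).
Variables (Lbar : closedFieldType) (iota : {rmorphism A -> L}).
Variables (phi : drinfeld_module iota) (emb : {rmorphism L -> Lbar}).
Variable a : A.
Hypothesis iota_a : iota a != 0.

Local Notation M := (drinfeld_points phi emb).
Local Notation N := (adjoint_points phi emb).
Local Notation q := #|Fq|.
Let k : {rmorphism Fq -> L} := iota \o GRing.in_alg A.
Let kbar : {rmorphism Fq -> Lbar} := emb \o k.

(** A nonzero scalar is a unit of A, so its image is a unit of L{tau}, hence constant. Thus Fq acts
    on the points of phi by ordinary multiplication. *)
Lemma drinfeld_scalar (l : Fq) : (phi l%:A : {poly L}) = (k l)%:P.
Proof.
rewrite -[k l]/(iota l%:A) -(drinfeld_const phi).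
have [->|l0] := eqVneq l 0.
  by rewrite scale0r rmorph0 -[RHS]/(((0 : {poly L})`_0)%:P) coef0.
apply: (@twisted_unit_const _ _ _ _ (phi (l^-1)%:A)).
by rewrite -rmorphM -scalerAl mul1r scalerA divff // scale1r rmorph1.
Qed.

Let constE (c : L) : (c%:P : {poly L}) = c *: 'X^0.
Proof. by rewrite expr0 alg_polyC. Qed.

Let scaleME (l : Fq) (x : M) : l%:A *: x = kbar l * x :> Lbar.
Proof.
rewrite -[LHS]/(twisted_act emb (phi l%:A) x) drinfeld_scalar constE.
by rewrite twisted_actZX expn0 expr1.
Qed.

Definition drinfeld_pairing n (x : M) (y : N) : Fq :=
  xget 0 [set l | kbar l = green emb (phi (a ^+ n)) x y].
Local Notation p := drinfeld_pairing.

Let torsM n (x : M) : a ^+ n *: x = 0 -> twisted_act emb (phi (a ^+ n)) x = 0.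
Proof. by []. Qed.
Let torsN n (y : N) : a ^+ n *: y = 0 -> adjoint_act emb (phi (a ^+ n)) y = 0.
Proof. by []. Qed.

Lemma drinfeld_pairingE n (x : M) (y : N) : a ^+ n *: x = 0 -> a ^+ n *: y = 0 ->
  kbar (p n x y) = green emb (phi (a ^+ n)) x y.
Proof.
move=> /torsM hx /torsN hy; set g := green _ _ _ _.
have [l lE] : exists l, kbar l = g.
  apply: frob_fixed_image; apply/eqP; rewrite -subr_eq0.
  by rewrite green_identity hx hy mulr0 mul0r subrr.
exact: (xgetPex 0 (ex_intro (fun l => kbar l = g) l lE)).
Qed.

Let phi_a n : (phi (a ^+ n) : {poly L})`_0 != 0.
Proof. by rewrite drinfeld_const rmorphXn expf_neq0. Qed.

(** Expand the form of phi_(c a^n) by [greenM] in both orders of the product; each time torsion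
    kills one of the two terms. *)
Let greenC n c (x : M) (y : N) : a ^+ n *: x = 0 -> a ^+ n *: y = 0 ->
  green emb (phi (a ^+ n)) (c *: x) y = green emb (phi (a ^+ n)) x (c *: y).
Proof.
move=> /torsM hx /torsN hy.
have := greenM emb (phi c) (phi (a ^+ n)) x y.
rewrite -rmorphM mulrC rmorphM greenM hx hy green0l green0r add0r addr0.
exact.
Qed.

Let Zt (P : lmodType A) n c (x : P) : a ^+ n *: x = 0 -> a ^+ n *: (c *: x) = 0.
Proof. by move=> h; rewrite scalerA mulrC -scalerA h scaler0. Qed.
Let Dt (P : lmodType A) n (x y : P) : a ^+ n *: x = 0 -> a ^+ n *: y = 0 ->
  a ^+ n *: (x + y) = 0.
Proof. by move=> h h'; rewrite scalerDr h h' addr0. Qed.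
Let Lt (P : lmodType A) m n (x : P) : a ^+ n *: x = 0 -> a ^+ (m + n) *: x = 0.
Proof. by move=> h; rewrite exprD -scalerA h scaler0. Qed.
Let Lt' (P : lmodType A) m n (x : P) : a ^+ (m + n) *: x = 0 ->
  a ^+ n *: (a ^+ m *: x) = 0.
Proof. by rewrite scalerA -exprD addnC. Qed.

Let kbarI : injective kbar. Proof. exact: fmorph_inj. Qed.

Let pDr n (x : M) (y z : N) : a ^+ n *: x = 0 -> a ^+ n *: y = 0 ->
  a ^+ n *: z = 0 -> p n x (y + z) = p n x y + p n x z.
Proof.
move=> hx hy hz; have hyz := Dt hy hz; apply: kbarI.
by rewrite rmorphD !drinfeld_pairingE // greenDr.
Qed.

Let pDl n (x z : M) (y : N) : a ^+ n *: x = 0 -> a ^+ n *: z = 0 ->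
  a ^+ n *: y = 0 -> p n (x + z) y = p n x y + p n z y.
Proof.
move=> hx hz hy; have hxz := Dt hx hz; apply: kbarI.
by rewrite rmorphD !drinfeld_pairingE // greenDl.
Qed.

Let pZ n (l : Fq) (x : M) (y : N) : a ^+ n *: x = 0 -> a ^+ n *: y = 0 ->
  p n (l%:A *: x) y = l * p n x y.
Proof.
move=> hx hy; have hlx := Zt l%:A hx; apply: kbarI.
by rewrite rmorphM !drinfeld_pairingE // scaleME green_scale.
Qed.

Let pB n c (x : M) (y : N) : a ^+ n *: x = 0 -> a ^+ n *: y = 0 ->
  p n (c *: x) y = p n x (c *: y).
Proof.
move=> hx hy; have hcx := Zt c hx; have hcy := Zt c hy; apply: kbarI.
by rewrite !drinfeld_pairingE // greenC.
Qed.

Lemma drinfeld_torsion_pairing : torsion_pairing a p.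
Proof.
split=> //.
- move=> m n x y hx hy; have hax := Lt' hx; have hy' := Lt m hy; apply: kbarI.
  rewrite !drinfeld_pairingE // addnC exprD rmorphM greenM (torsN hy) green0r addr0.
  by [].
- move=> n y hy H; apply: (green_nondegr (phi_a n) (torsN hy)) => x hx.
  by rewrite -(drinfeld_pairingE (x := x) hx hy) H ?rmorph0.
Qed.

Lemma adjoint_torsion_pairing : torsion_pairing a (fun n (y : N) (x : M) => p n x y).
Proof.
split.
- by move=> n y x z hy hx hz; apply: pDl.
- by move=> n l y x hy hx; rewrite -pB // pZ.
- by move=> n c y x hy hx; rewrite pB.
- move=> m n y x hy hx; have hay := Lt' hy; have hx' := Lt m hx; apply: kbarI.
  by rewrite !drinfeld_pairingE // exprD rmorphM greenM (torsM hx) green0l add0r.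
- move=> n x hx H; apply: (green_nondegl (phi_a n) (torsM hx)) => y hy.
  by rewrite -(drinfeld_pairingE (y := y) hx hy) H ?rmorph0.
Qed.

Lemma drinfeld_finite n : exists s : seq M, forall m, a ^+ n *: m = 0 -> m \in s.
Proof. by have [s sP] := twisted_ker_finite emb (phi_a n); exists s. Qed.
Lemma adjoint_finite n : exists s : seq N, forall m, a ^+ n *: m = 0 -> m \in s.
Proof. by have [s sP] := adjoint_ker_finite emb (phi_a n); exists s. Qed.
Lemma drinfeld_divisible (m : M) : exists m', a *: m' = m.
Proof. by have [z zP] := twisted_act_surj emb (phi_a 1) m; exists z. Qed.
Lemma adjoint_divisible (m : N) : exists m', a *: m' = m.
Proof. by have [z zP] := adjoint_act_surj emb (phi_a 1) m; exists z. Qed.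

(** The form is built from field operations and q-power roots, which commute with sigma, and its
    value lies in the image of Fq, which sigma fixes. *)
Lemma drinfeld_pairing_galois (sigma : galois_aut emb) n (x : M) (y : N) :
  a ^+ n *: x = 0 -> a ^+ n *: y = 0 ->
  p n (galois_drinfeld sigma x) (galois_adjoint sigma y) = p n x y.
Proof.
move=> hx hy; apply: kbarI.
have hsx : a ^+ n *: galois_drinfeld (phi := phi) sigma x = 0.
  by rewrite -linearZ hx linear0.
have hsy : a ^+ n *: galois_adjoint (phi := phi) sigma y = 0.
  by rewrite -linearZ hy linear0.
have fix_p : sigma (kbar (p n x y)) = kbar (p n x y) by exact: galois_fix.
rewrite drinfeld_pairingE // -[RHS]fix_p drinfeld_pairingE //.
have sr m z : sigma (qroot Fq m z) = qroot Fq m (sigma z).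
  by apply/esym/(qroot_eq k emb); rewrite -rmorphXn qrootK.
rewrite /green rmorph_sum; apply: eq_bigr => i _.
rewrite /qtrace rmorph_sum; apply: eq_bigr => l _.
rewrite [RHS]rmorphXn [in RHS](rmorphM (galois_fun sigma)).
by rewrite [in RHS](rmorphM (galois_fun sigma)) !sr galois_fix.
Qed.

End DrinfeldPairing.

(** * Completions *)

Section Valuation.
Variables (F : fieldType) (v : discrete_valuation F).

Lemma val_ge0 n : val_ge v n 0.
Proof. by rewrite /val_ge eqxx. Qed.

Lemma dval1 : v 1 = 0.
Proof.
have := dvalM v (oner_neq0 F) (oner_neq0 F); rewrite mulr1.
by move/(congr1 (fun z => z - v 1)); rewrite addrK subrr.
Qed.

Lemma dvalV x : x != 0 -> v x^-1 = - v x.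
Proof.
move=> x0; have xV0 : x^-1 != 0 by rewrite invr_eq0.
by apply/eqP; rewrite -addr_eq0 -dvalM // mulVf // dval1.
Qed.

Lemma dvalN1 : v (-1) = 0.
Proof.
have n0 : (-1 : F) != 0 by rewrite oppr_eq0 oner_neq0.
have := dvalM v n0 n0; rewrite mulrNN mulr1 dval1 => /esym/eqP.
by rewrite -mulr2n Num.Theory.mulrn_eq0 => /eqP.
Qed.

Lemma dvalX x n : x != 0 -> v (x ^+ n) = n%:Z * v x.
Proof.
move=> x0; elim: n => [|n IH]; first by rewrite expr0 dval1 mul0r.
by rewrite exprS dvalM ?expf_neq0 // IH -[n.+1]add1n PoszD mulrDl mul1r.
Qed.

Lemma val_geD n x y : val_ge v n x -> val_ge v n y -> val_ge v n (x + y).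
Proof.
rewrite /val_ge; have [->|x0] := eqVneq x 0; first by rewrite add0r.
have [->|y0] := eqVneq y 0; first by rewrite addr0 (negbTE x0).
have [//|xy0] := eqVneq (x + y) 0 => /= hx hy.
apply: Order.POrderTheory.le_trans (dvalD v x0 y0 xy0).
by rewrite Order.TotalTheory.le_min hx hy.
Qed.

Lemma val_geM n m x y : val_ge v n x -> val_ge v m y -> val_ge v (n + m) (x * y).
Proof.
rewrite /val_ge mulf_eq0; case: eqVneq => //= x0; case: eqVneq => //= y0 hx hy.
by rewrite dvalM // Num.Theory.lerD.
Qed.

Lemma val_geN n x : val_ge v n x -> val_ge v n (- x).
Proof.
rewrite /val_ge oppr_eq0; case: eqVneq => //= x0.
by rewrite -mulN1r dvalM // ?oppr_eq0 ?oner_neq0 // dvalN1 add0r.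
Qed.

Lemma val_geB n x y : val_ge v n x -> val_ge v n y -> val_ge v n (x - y).
Proof. by move=> hx hy; apply: val_geD => //; apply: val_geN. Qed.

Lemma val_geW n m x : m <= n -> val_ge v n x -> val_ge v m x.
Proof.
move=> mn; rewrite /val_ge; case: eqVneq => //= x0.
exact: Order.POrderTheory.le_trans.
Qed.

End Valuation.

(** * The completion at q and its residue field *)

Section Completion.
Variables (Fq : finFieldType) (A : comAlgType Fq) (K : fieldType).
Variables (i : {rmorphism A -> K}) (q : prime_idealr A).
Variables (Aq : comNzRingType) (Kq : fieldType) (j : {rmorphism A -> Aq}).
Variables (k : {rmorphism K -> Kq}) (e : {rmorphism Aq -> Kq}).
Variable (v : discrete_valuation Kq).
Hypothesis hq : completion_at i q j k e v.

Let einj := completion_int_inj hq.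
Let eint x : val_ge v 0 x -> exists c, e c = x.
Proof. by move/(completion_int hq). Qed.
Let vint c : val_ge v 0 (e c).
Proof. by apply/(completion_int hq); exists c. Qed.

Let val_power a (n : nat) : val_ge v n (e (j a)) <-> ideal_power q n a.
Proof. by rewrite -(completion_comm hq); apply: completion_val hq a n. Qed.

Lemma ideal_power1 (x : A) : ideal_power q 1 x <-> x \in q.
Proof.
split=> [[s [sq ->]]|xq].
  rewrite big_seq; apply: rpred_sum => ab /sq [abq _].
  by rewrite mulrC idealMr.
exists [:: (x, 1)]; split=> [ab|]; last by rewrite big_seq1 mulr1.
by rewrite inE => /eqP ->.
Qed.

Let val1 a : val_ge v 1 (e (j a)) <-> a \in q.
Proof. by rewrite -ideal_power1; apply: val_power. Qed.

(** Suppose q lies in the kernel of iota. A kernel element b outside q is a unit of [Aq];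
    approximating its inverse by a' in A puts 1 - a' b in q, hence 1 in the kernel. The completion
    thus supplies the maximality of q. *)
Lemma prime_not_in_kernel (L : fieldType) (iota : {rmorphism A -> L}) :
  ~ (q =i [pred a | iota a == 0]) -> exists2 a, a \in q & iota a != 0.
Proof.
move=> neq; apply: contrapT => H.
have qker x : x \in q -> iota x = 0.
  by move=> xq; apply: contrapT => /eqP x0; apply: H; exists x.
apply: neq => b; rewrite inE; apply/idP/idP => [/qker ->|/eqP b0]; first by rewrite eqxx.
apply: contrapT => bq; have nb : ~~ val_ge v 1 (e (j b)) by apply/negP => /val1.
have eb0 : e (j b) != 0 by apply: contraNneq nb => ->; apply: val_ge0.
have vb : v (e (j b)) = 0.
  have := vint (j b); rewrite /val_ge in nb *; rewrite !(negbTE eb0) /= in nb *.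
  by case: (v _) nb => [[|n]|n].
have [|c cE] := @eint (e (j b))^-1.
  by rewrite /val_ge dvalV // vb oppr0 Order.POrderTheory.lexx orbT.
have [a' ha'] := completion_int_dense hq c 1.
have : 1 - a' * b \in q.
  apply/val1; have -> : e (j (1 - a' * b)) = e (c - j a') * e (j b).
    by rewrite !rmorphB !rmorphM !rmorph1 mulrBl cE mulVf.
  by have := val_geM ha' (vint (j b)); rewrite addr0.
by move/qker/eqP; rewrite rmorphB rmorph1 rmorphM b0 mulr0 subr0 oner_eq0.
Qed.

(** Approximate an element of valuation 1 by b in A up to valuation 2. If iota b = 0, add the square
    of an element of q outside the kernel of iota: the valuation stays 1. That iota a is nonzero
    makes the operators phi_(a^n) separable. *)
Lemma uniformizer_exists (L : fieldType) (iota : {rmorphism A -> L}) :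
  ~ (q =i [pred a | iota a == 0]) ->
  exists a, [/\ iota a != 0, e (j a) != 0 & v (e (j a)) = 1].
Proof.
move=> neq; have [a0 a0q ia0] := prime_not_in_kernel neq.
have [x x0 vx] := dval_onto v.
have [|c cE] := @eint x; first by rewrite /val_ge vx orbT.
have [b hb] := completion_int_dense hq c 2.
have near b' : val_ge v 2 (x - e (j b')) -> e (j b') != 0 /\ v (e (j b')) = 1.
  move=> hb'; have nx : ~~ val_ge v 2 x by rewrite /val_ge negb_or x0 vx.
  have n2 : ~~ val_ge v 2 (e (j b')).
    by apply: contra nx => h; rewrite -(subrK (e (j b')) x); apply: val_geD.
  have g1 : val_ge v 1 (e (j b')).
    rewrite -[e (j b')](subKr x); apply: val_geB; first by rewrite /val_ge vx orbT.
    by apply: val_geW hb'.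
  have nz : e (j b') != 0 by apply: contraNneq n2 => ->; apply: val_ge0.
  split=> //; rewrite /val_ge !(negbTE nz) /= in g1 n2.
  by case: (v _) g1 n2 => [[|[|n]]|n].
rewrite rmorphB cE in hb.
have [ib|ib] := eqVneq (iota b) 0; last first.
  by exists b; have [] := near b hb.
exists (b + a0 ^+ 2).
have [|nz v1] := near (b + a0 ^+ 2).
  rewrite !rmorphD opprD addrA; apply: val_geB => //.
  have /val1 h := a0q; have := val_geM h h; rewrite -!rmorphM -expr2.
  exact.
by split=> //; rewrite rmorphD ib add0r rmorphXn expf_neq0.
Qed.

Variable a : A.
Hypotheses (w0 : e (j a) != 0) (va : v (e (j a)) = 1).
Local Notation w := (e (j a)).

Lemma val_div n x : val_ge v n%:Z x -> exists c, x = w ^+ n * e c.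
Proof.
move=> h; have [|c cE] := @eint (x / w ^+ n); last first.
  by exists c; rewrite cE mulrC divfK // expf_neq0.
rewrite -(subrr n%:Z); apply: val_geM => //.
by rewrite /val_ge dvalV ?expf_neq0 // dvalX // va mulr1 Order.POrderTheory.lexx orbT.
Qed.

Let val_w (n : nat) : val_ge v n (w ^+ n).
Proof. by rewrite /val_ge dvalX // va mulr1 Order.POrderTheory.lexx orbT. Qed.

Let val_wM (n : nat) c : val_ge v n (w ^+ n * e c).
Proof. by have := val_geM (val_w n) (vint c); rewrite addr0. Qed.

Lemma adiv_power n b : adiv j a n b <-> ideal_power q n b.
Proof.
rewrite -val_power; split=> [[c hc]|/val_div [c hc]].
  by rewrite hc rmorphM rmorphXn; apply: val_wM.
by exists c; apply: einj; rewrite hc rmorphM rmorphXn.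
Qed.

Lemma completion_uniformizer : uniformizer j e a.
Proof.
split=> //.
- move=> x; have [->|x0] := eqVneq x 0.
    by exists 0%N, 0; rewrite mulr0 rmorph0.
  exists `|v x|%N; have [|c cE] := @eint (w ^+ `|v x|%N * x); last by exists c.
  rewrite /val_ge dvalM ?expf_neq0 // dvalX // va mulr1; apply/orP; right.
  by case: (v x) => n; rewrite // NegzE /= addrN.
- move=> c n; have [b hb] := completion_int_dense hq c n.
  have [c' hc'] := val_div hb; exists b, c'; apply: einj.
  by rewrite rmorphD rmorphM rmorphXn -hc' -rmorphD addrC subrK.
- move=> n b /adiv_power [s [sP ->]] Q Q0 QD QM.
  rewrite big_seq; elim/big_ind: _ => // ab /sP [ab1 ab2].
  by apply: QM; apply/adiv_power => //; apply/ideal_power1.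
Qed.

Lemma completion_nonunit c : e c != w^-1.
Proof.
apply/eqP => h; have := vint c.
by rewrite h /val_ge invr_eq0 (negbTE w0) dvalV // va.
Qed.

Lemma completion_unit_or_div c :
  (exists c', c = j a * c') \/ (exists c', c * c' = 1).
Proof.
have [/(@val_div 1) [c' h]|n1] := boolP (val_ge v 1 (e c)).
  by left; exists c'; apply: einj; rewrite h rmorphM expr1.
have c0 : e c != 0 by apply: contraNneq n1 => ->; apply: val_ge0.
have vc : v (e c) = 0.
  have := vint c; rewrite /val_ge in n1 *; rewrite !(negbTE c0) /= in n1 *.
  by case: (v _) n1 => [[|n]|n].
have [|c' cE] := @eint (e c)^-1.
  by rewrite /val_ge dvalV // vc oppr0 Order.POrderTheory.lexx orbT.
by right; exists c'; apply: einj; rewrite rmorphM cE divff // rmorph1.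
Qed.

Lemma completion_series (u : nat -> Aq) : exists c, forall n, exists c',
  c = \sum_(m < n) u m * j a ^+ m + j a ^+ n * c'.
Proof.
pose U n := \sum_(m < n) u m * j a ^+ m.
have UnS (n m : nat) : val_ge v n (e (U (m + n)%N) - e (U n)).
  elim: m => [|m IH]; first by rewrite subrr val_ge0.
  rewrite addSn [U _.+1]big_ord_recr /= rmorphD -/(U _) addrAC; apply: val_geD => //.
  rewrite exprD mulrA mulrC rmorphM rmorphXn; exact: val_wM.
have Un (n m : nat) : (n <= m)%N -> val_ge v n (e (U m) - e (U n)).
  by move=> nm; rewrite -(subnK nm).
have [|l lP] := completion_complete hq (u := fun n => e (U n)).
  move=> n; exists n => m m' nm nm'.
  rewrite -[_ - _](subrKA (e (U n))) -[e (U n) - _]opprB.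
  by apply: val_geB; apply: Un.
have lU (n : nat) : val_ge v n (l - e (U n)).
  have [N NP] := lP n; have := NP (maxn N n) (leq_maxl _ _) => h.
  have h' := Un n (maxn N n) (leq_maxr _ _).
  have -> : l - e (U n) = (e (U (maxn N n)) - e (U n)) - (e (U (maxn N n)) - l) by ring.
  exact: val_geB.
have [|c cE] := @eint l.
  by have := lU 0%N; rewrite /U big_ord0 rmorph0 subr0.
exists c => n; have [c' hc'] := val_div (lU n); exists c'; apply: einj.
by rewrite rmorphD cE rmorphM rmorphXn -hc' addrC subrK.
Qed.

(** The growth bound gives a relation among the a^r u_s. Cancelling the lowest power of a that
    occurs leaves a nontrivial combination of the u_s that is a multiple of a. *)
Lemma residue_dependence : function_field (i \o GRing.in_alg A) -> injective i ->
  exists m, forall u : 'I_m -> A, exists2 l : 'I_m -> Fq, (exists r, l r != 0) &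
    adiv j a 1 (\sum_r l r *: u r).
Proof.
move=> ffK iinj; have [m mP] := function_field_growth (i a) ffK.
exists m => u; have [n [lam [[r0 s0] lam0] lamP]] := mP (fun r => i (u r)).
have [n0 [s1 lam1] n0min] : exists2 n0 : 'I_n, (exists s, lam (n0, s) != 0) &
    forall r : 'I_n, (r < n0)%N -> forall s, lam (r, s) = 0.
  pose P (r : 'I_n) := [exists s, lam (r, s) != 0].
  have Pr0 : P r0 by apply/existsP; exists s0.
  have [n0 /existsP Pn0 min0] := arg_minnP (fun r : 'I_n => r : nat) Pr0.
  exists n0 => // r rn0 s; apply/eqP/negPn/negP => h.
  have /min0 : P r by apply/existsP; exists s.
  by rewrite leqNgt rn0.
exists (fun s => lam (n0, s)); first by exists s1.
have sumA : \sum_(r < n) a ^+ r * (\sum_s lam (r, s) *: u s) = 0.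
  apply: iinj; rewrite rmorph0 -[RHS]lamP rmorph_sum.
  rewrite [RHS](eq_bigr (fun rs =>
    i (lam (rs.1, rs.2))%:A * (i a ^+ rs.1 * i (u rs.2)))); last by case.
  rewrite -(pair_bigA _ (fun (r : 'I_n) (s : 'I_m) =>
    i (lam (r, s))%:A * (i a ^+ r * i (u s)))) /=.
  apply: eq_bigr => r _; rewrite rmorphM rmorphXn rmorph_sum mulr_sumr.
  by apply: eq_bigr => s _; rewrite -[_ *: u s]mul1r -scalerAr scalerAl rmorphM mulrCA.
rewrite (bigID (fun r : 'I_n => (r < n0)%N)) /= big1 ?add0r in sumA; last first.
  by move=> r rn0; rewrite big1 ?mulr0 // => s _; rewrite n0min // scale0r.
rewrite (bigD1 n0) ?ltnn //= in sumA.
have [d dE] : exists d, \sum_(r < n | ~~ (r < n0)%N && (r != n0))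
    a ^+ r * (\sum_s lam (r, s) *: u s) = a ^+ n0.+1 * d.
  elim/big_ind: _ => [|x y [d ->] [d' ->]|r /andP[rn0 rn0']].
  - by exists 0; rewrite mulr0.
  - by exists (d + d'); rewrite mulrDr.
  have rn : (n0 < r)%N by rewrite ltn_neqAle eq_sym rn0' leqNgt rn0.
  by rewrite -(subnK rn) addnC exprD -mulrA; eexists.
rewrite dE in sumA; exists (j (- d)); apply: einj.
have wn0 : w ^+ n0 != 0 by rewrite expf_neq0.
apply: (mulfI wn0); rewrite -!rmorphXn -!rmorphM.
move/eqP: sumA; rewrite addr_eq0 => /eqP ->; congr (e _).
by congr (j _); rewrite exprSr !mulrN mulrA.
Qed.

Lemma completion_residue_finite :
  function_field (i \o GRing.in_alg A) -> injective i ->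
  exists s : seq A, forall c, exists (l : A -> Fq) c',
    c = \sum_(d <- s) j ((l d)%:A * d) + j a * c'.
Proof.
move=> ffK iinj; have [m mP] := residue_dependence ffK iinj.
have [||s sP] := @span_modulo Fq A (adiv j a 1) m _ _ mP.
- exact: adiv0.
- by move=> l x hx; rewrite -[x]mul1r scalerAl; apply: adivMl.
exists s => c; have [b [c1 ->]] := unif_dense completion_uniformizer c 1.
have [l [c2 h]] := sP b; exists l, (c2 + c1); rewrite expr1 in h *.
rewrite mulrDr addrA -h rmorphB rmorph_sum.
congr (_ + _); rewrite [RHS]addrC -[LHS](subrK (\sum_(d <- s) j ((l d)%:A * d))).
congr (_ - _ + _); apply: eq_bigr => d _.
by rewrite -scalerAl mul1r.
Qed.

End Completion.

Theorem proposition10p1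
  (Fq : finFieldType) (A : comAlgType Fq) (K : fieldType)
  (i : {rmorphism A -> K}) (oo : discrete_valuation K)
  (hA : regular_ring i oo)
  (L : fieldType) (iota : {rmorphism A -> L}) (phi : drinfeld_module iota)
  (Lbar : closedFieldType) (emb : {rmorphism L -> Lbar})
  (hLbar : forall z : Lbar, algebraicOver emb z)
  (q : prime_idealr A)
  (q_neq0 : exists2 a, a \in q & a != 0)
  (q_neq_char : ~ (q =i [pred a | iota a == 0]))
  (Aq : comNzRingType) (Kq : fieldType) (j : {rmorphism A -> Aq})
  (k : {rmorphism K -> Kq}) (e : {rmorphism Aq -> Kq})
  (v : discrete_valuation Kq)
  (hq : completion_at i q j k e v) :
  (exists B : {bilinear tate phi emb j e -> tate_adjoint phi emb j e
                 -> residue_dual Fq A j e},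
     [/\ forall (sigma : galois_aut emb) t s,
           B (tate_galois sigma t) (tate_adjoint_galois sigma s) = B t s,
         continuous (fun ts : tate phi emb j e * tate_adjoint phi emb j e =>
           (B ts.1 ts.2 : residue_dual Fq A j e))
       & perfect_pairing B]) /\
  (exists f : {linear Aq^o -> residue_dual Fq A j e}, bijective f).
Proof.
have [a [ia wa va]] := uniformizer_exists hq q_neq_char.
have hU := completion_uniformizer hq wa va.
split; last first.
  apply: (residue_dual_free hU).
  - exact: (completion_nonunit hq wa va).
  - exact: (completion_unit_or_div hq wa va).
  - exact: (completion_residue_finite hq wa va (regular_curve hA) (regular_inj hA)).
  - exact: (completion_series hq wa va).
have [B [BE Bcont Bperf]] := tate_pairing hU
  (@drinfeld_torsion_pairing _ _ _ _ _ phi emb a ia)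
  (@adjoint_torsion_pairing _ _ _ _ _ phi emb a ia)
  (@drinfeld_finite _ _ _ _ _ phi emb a ia)
  (@adjoint_finite _ _ _ _ _ phi emb a ia)
  (@drinfeld_divisible _ _ _ _ _ phi emb a ia)
  (@adjoint_divisible _ _ _ _ _ phi emb a ia).
exists B; split=> // sigma t s; apply: quot_hom_ext => x.
have [n [c h]] := unif_denom hU x.
have tx : a ^+ n *: t x = 0 by apply: tors_a; apply: tate_int h.
have sx : a ^+ n *: s (e (j a) ^- n) = 0 by apply: tors_a; apply: (tate_tors hU).
by rewrite !(BE _ _ _ _ _ h); apply: (drinfeld_pairing_galois sigma tx sx).
Qed.
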